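(* For $n\ge1$ let $N_{vc}(n)$ be the total number of pairs $(A,C)$ where $A$ is a labeled tree on $\{1,\dots,n\}$ and $C$ is a minimum-cardinality vertex cover of $A$. Let $F_{vc}(x)=\sum_{n\ge1}\frac{N_{vc}(n)}{n!}x^n$ and $T(x)=\sum_{n\ge1}\frac{n^{n-1}}{n!}x^n$. Then, as formal power series, $$F_{vc}(x)=(1-U)xe^U-U\,T(x^2e^{2U})+U-\tfrac12U^2,$$ where $U=U(x)$ is the formal power series with $U(0)=0$ satisfying $xUe^U=T(x^2e^{2U})\big(e^{xe^U}-1\big)$. The first values ($n=1,\dots,10$) are $N_{vc}=(1,2,3,40,185,3936,35917,978160,14301513,464105440)$.
   Context: A vertex cover of a graph is a set of vertices containing at least one end-vertex of every edge; minimum-cardinality means of smallest possible size (the empty set is the minimum vertex cover of the one-vertex tree). *)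

(* Defs.v *)
From mathcomp Require Import all_boot all_order all_algebra.
From mathcomp Require Import boolp.
Set Implicit Arguments. Unset Strict Implicit. Unset Printing Implicit Defensive.
Import Order.TTheory GRing.Theory Num.Theory.

(* ---------- Labeled trees on n vertices ----------
   Vertices are 'I_n = {0,...,n-1} (relabeling of {1,...,n}).
   A simple graph is given by its edge set E : {set {set 'I_n}}, each edge
   being a 2-element subset of vertices. *)

Section Graphs.
Variable n : nat.

Definition simple_graph (E : {set {set 'I_n}}) : bool :=
  [forall e in E, #|e| == 2].

Definition adj (E : {set {set 'I_n}}) : rel 'I_n :=
  fun x y => (x != y) && ([set x; y] \in E).

Definition connected_graph (E : {set {set 'I_n}}) : Prop :=
  forall x y : 'I_n, connect (adj E) x y.

Definition acyclic (E : {set {set 'I_n}}) : Prop :=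
  ~ exists s : seq 'I_n, [/\ 3 <= size s, uniq s & cycle (adj E) s].

Definition is_tree (E : {set {set 'I_n}}) : Prop :=
  [/\ simple_graph E, connected_graph E & acyclic E].

Definition vertex_cover (E : {set {set 'I_n}}) (C : {set 'I_n}) : bool :=
  [forall e in E, e :&: C != set0].

Definition min_vertex_cover (E : {set {set 'I_n}}) (C : {set 'I_n}) : bool :=
  vertex_cover E C &&
  [forall C' : {set 'I_n}, vertex_cover E C' ==> (#|C| <= #|C'|)].

End Graphs.

Definition N_vc (n : nat) : nat :=
  #|[set p : {set {set 'I_n}} * {set 'I_n} |
      asbool (is_tree p.1) && min_vertex_cover p.1 p.2]|.

Local Open Scope ring_scope.

Definition fps := nat -> rat.

Definition fadd (f g : fps) : fps := fun k => f k + g k.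
Definition fsub (f g : fps) : fps := fun k => f k - g k.
Definition fscale (c : rat) (f : fps) : fps := fun k => c * f k.
Definition fmul (f g : fps) : fps :=
  fun k => \sum_(i < k.+1) f i * g (k - i)%N.
Definition fconst (c : rat) : fps := fun k => if k == 0%N then c else 0.
Definition fone : fps := fconst 1.
Definition fX : fps := fun k => if k == 1%N then 1 else 0.
Fixpoint fpow (f : fps) (m : nat) : fps :=
  match m with 0%N => fone | m'.+1 => fmul f (fpow f m') end.

(* composition f(g), meaningful (and used only) when g 0 = 0:
   [x^k] f(g) = sum_{j <= k} f_j [x^k] g^j *)
Definition fcomp (f g : fps) : fps :=
  fun k => \sum_(j < k.+1) f j * fpow g j k.

Definition expS : fps := fun k => (k`!%:R)^-1.
Definition fexp (g : fps) : fps := fcomp expS g.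

Definition Tser : fps :=
  fun k => if k == 0%N then 0 else (k ^ k.-1)%:R / k`!%:R.

Definition Fvc : fps :=
  fun k => if k == 0%N then 0 else (N_vc k)%:R / k`!%:R.

Definition U_equation (U : fps) : Prop :=
  fmul fX (fmul U (fexp U)) =
  fmul (fcomp Tser (fmul (fpow fX 2) (fexp (fscale 2 U))))
       (fsub (fexp (fmul fX (fexp U))) fone).

Definition Fvc_formula (U : fps) : fps :=
  fadd (fsub (fmul (fsub fone U) (fmul fX (fexp U)))
             (fmul U (fcomp Tser (fmul (fpow fX 2) (fexp (fscale 2 U))))))
       (fsub U (fscale (1/2) (fpow U 2))).

(* Main.v *)
From Stdlib Require Import NArith.
From HB Require Import structures.
Require Import Defs.
From mathcomp Require Import all_boot all_order all_algebra.
From mathcomp Require Import boolp.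
From mathcomp Require Import ring zify.
From mathcomp.algebra_tactics Require common.
Set Implicit Arguments. Unset Strict Implicit. Unset Printing Implicit Defensive.
Import Order.TTheory GRing.Theory Num.Theory.
Local Open Scope ring_scope.

(* Root every tree at the same vertex and sort the pairs (rooted tree, cover) by
   whether the minimum covers avoid the root, may contain it, or must contain
   it.  Attaching a subtree by an edge at the root acts bilinearly on the numbers
   of pairs in each class.  Cutting a tree at the edge that leads from the root
   to a second marked vertex inverts this, so these numbers obey a quadratic
   recursion, which computes the first values and becomes a system of
   differential equations for the exponential generating functions.  Its solution
   is explicit in terms of exponentials and of a series U and, since
   T = x exp(T) by Abel's identity, U satisfies the functional equation.  Both
   sides of the formula for F_vc have the same image under x d/dx. *)

(** * Formal power series *)

(** When two trees of type A are joined, neither root lies in a minimum cover, so covering the new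
    edge costs one more vertex, paid on either side. This is why covers one larger than minimum must
    be counted, and only in type A. Consequently a root is of type A, B or C according as it has no,
    exactly one, or at least two branches of type A; [exp(x exp(U)) - 1] stands for the nonempty
    sets of such branches, each with its root outside the cover, and [U] itself counts rooted pairs
    whose minimum cover contains the root. The second marked vertex singles out one branch at the
    root. A tree thus becomes a pair of smaller rooted trees instead of a root with an unordered set
    of branches, and the decomposition is a bijection. Letting the root vary over all n vertices
    multiplies the counts by n, so the series that appear naturally add up to [x d/dx] of F_vc; the
    stated formula is an antiderivative. As the theorem speaks of every solution [U] of the
    functional equation, uniqueness of that solution is needed as well. *)

HB.instance Definition _ := gen_eqMixin fps.
HB.instance Definition _ := gen_choiceMixin fps.

Definition fopp (f : fps) : fps := fun k => - f k.

Fact faddA : associative fadd.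
Proof. by move=> f g h; apply/funext => k; rewrite /fadd addrA. Qed.
Fact faddC : commutative fadd.
Proof. by move=> f g; apply/funext => k; rewrite /fadd addrC. Qed.
Fact fadd0 : left_id (fconst 0) fadd.
Proof. by move=> f; apply/funext => k; rewrite /fadd /fconst if_same add0r. Qed.
Fact faddN : left_inverse (fconst 0) fopp fadd.
Proof.
by move=> f; apply/funext => k; rewrite /fadd /fopp /fconst if_same addNr.
Qed.
HB.instance Definition _ := GRing.isZmodule.Build fps faddA faddC fadd0 faddN.

Definition trunc (N : nat) (f : fps) : {poly rat} := \poly_(i < N) f i.

Lemma coef_trunc N f k : (k < N)%N -> (trunc N f)`_k = f k.
Proof. by move=> ltkN; rewrite coef_poly ltkN. Qed.

(** Transfers the ring laws from [{poly rat}]: coefficient [k] of a product only sees the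
    coefficients up to [k] of the factors. *)
Lemma fmul_trunc N f g k :
  (k < N)%N -> fmul f g k = (trunc N f * trunc N g)`_k.
Proof.
move=> ltkN; rewrite coefM; apply: eq_bigr => i _.
by rewrite !coef_trunc // (leq_ltn_trans _ ltkN) ?leq_subr // -ltnS.
Qed.

Fact fmulC : commutative fmul.
Proof.
move=> f g; apply/funext => k.
by rewrite !(@fmul_trunc k.+1) // mulrC.
Qed.
Fact fmulA : associative fmul.
Proof.
move=> f g h; apply/funext => k.
have E f1 f2 f3 : fmul (fmul f1 f2) f3 k
    = (trunc k.+1 f1 * trunc k.+1 f2 * trunc k.+1 f3)`_k.
  rewrite coefM; apply: eq_bigr => i _.
  by rewrite (@fmul_trunc k.+1) // coef_trunc // ltnS leq_subr.
by rewrite fmulC !E [in LHS]mulrC mulrA.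
Qed.
Fact fmul1 : left_id fone fmul.
Proof.
move=> f; apply/funext => k; rewrite /fmul big_ord_recl /= mul1r subn0.
by rewrite big1 ?addr0 // => i _; rewrite mul0r.
Qed.
Fact fmulDl : left_distributive fmul fadd.
Proof.
move=> f g h; apply/funext => k; rewrite /fmul /fadd -big_split /=.
by apply: eq_bigr => i _; rewrite mulrDl.
Qed.
Fact fone_neq0 : fone != (0 : fps).
Proof. by apply/eqP => /(congr1 (fun f : fps => f 0%N)). Qed.
HB.instance Definition _ := GRing.Zmodule_isComNzRing.Build fps
  fmulA fmulC fmul1 fmulDl fone_neq0.

Lemma faddE (f g : fps) k : (f + g : fps) k = f k + g k.
Proof. by []. Qed.
Lemma foppE (f : fps) k : (- f : fps) k = - f k.
Proof. by []. Qed.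
Lemma fmulE (f g : fps) k : (f * g : fps) k = \sum_(i < k.+1) f i * g (k - i)%N.
Proof. by []. Qed.
Lemma f0E k : (0 : fps) k = 0.
Proof. by rewrite [LHS]/(fconst 0 k) /fconst if_same. Qed.
Lemma f1E k : (1 : fps) k = (k == 0%N)%:R.
Proof. by rewrite [LHS]/(fone k) /fone /fconst; case: eqP. Qed.
Lemma fscaleR (c : rat) f : fscale c f = fconst c * f.
Proof.
apply/funext => k; rewrite fmulE big_ord_recl /= subn0.
by rewrite big1 ?addr0 // => i _; rewrite mul0r.
Qed.
Lemma fpowR f m : fpow f m = f ^+ m.
Proof. by elim: m => // m IH; rewrite exprS -IH. Qed.
Lemma fsumE I r (P : pred I) (F : I -> fps) k :
  (\sum_(i <- r | P i) F i : fps) k = \sum_(i <- r | P i) F i k.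
Proof. by apply: (big_morph (fun f : fps => f k)) => //; apply: f0E. Qed.
Lemma fnatE m k : (m%:R : fps) k = if k == 0%N then m%:R else 0.
Proof.
elim: m => [|m IH]; first by rewrite mulr0n f0E if_same.
by rewrite -addn1 natrD mulr1n faddE IH f1E; case: eqP; rewrite ?addr0 // natrD.
Qed.
Lemma fconst_nat m : fconst m%:R = m%:R.
Proof. by apply/funext => k; rewrite fnatE. Qed.

Lemma fmul0E (f g : fps) : (f * g : fps) 0%N = f 0%N * g 0%N.
Proof. by rewrite fmulE big_ord1. Qed.
Lemma fXmulS (f : fps) k : (fX * f : fps) k.+1 = f k.
Proof.
rewrite fmulE big_ord_recl mul0r add0r big_ord_recl mul1r /= subSS subn0.
by rewrite big1 ?addr0 // => i _; rewrite mul0r.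
Qed.
Lemma fXmul0 (f : fps) : (fX * f : fps) 0%N = 0.
Proof. by rewrite fmul0E mul0r. Qed.

Lemma fexpr_eq0 (g : fps) j k : g 0%N = 0 -> (k < j)%N -> (g ^+ j : fps) k = 0.
Proof.
move=> g0; elim: j k => // j IH k ltkj; rewrite exprS fmulE.
rewrite big_ord_recl g0 mul0r add0r big1 // => i _; rewrite IH ?mulr0 //.
by rewrite lift0 (leq_trans _ (ltkj : (k <= j)%N)) // ltn_subrL; case: k i ltkj => // [[]].
Qed.

(** [g ^+ j] has order at least [j], so the cut-off in [fcomp] may be raised freely. A cut-off that
    does not depend on the coefficient is what allows exchanging sums. *)
Lemma fcompE f (g : fps) N k : g 0%N = 0 -> (k < N)%N ->
  fcomp f g k = \sum_(j < N) f j * (g ^+ j : fps) k.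
Proof.
move=> g0 ltkN; rewrite /fcomp (big_ord_widen N (fun j => f j * fpow g j k)) //.
rewrite big_mkcond; apply: eq_bigr => j _; rewrite fpowR ltnS.
by case: leqP => // ltkj; rewrite fexpr_eq0 // mulr0.
Qed.

Lemma fcomp0 f (g : fps) : fcomp f g 0%N = f 0%N.
Proof. by rewrite /fcomp big_ord1 mulr1. Qed.

Lemma fcompX (g : fps) : g 0%N = 0 -> fcomp fX g = g.
Proof.
move=> g0; apply/funext => k; rewrite (@fcompE _ _ k.+2) //.
rewrite big_ord_recl mul0r add0r big_ord_recl mul1r expr1.
by rewrite big1 ?addr0 // => i _; rewrite mul0r.
Qed.

(** Both sides are the double sum of [f a * h b * g ^+ (a + b)] over [a, b <= k]; the terms with
    [a + b > k] vanish at [k]. *)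
Lemma fcompM (f h g : fps) :
  g 0%N = 0 -> fcomp (f * h) g = fcomp f g * fcomp h g.
Proof.
move=> g0; apply/funext => k; rewrite fmulE.
rewrite (@fcompE _ _ k.+1) //.
have -> : \sum_(i < k.+1) fcomp f g i * fcomp h g (k - i)%N =
   \sum_(a < k.+1) \sum_(b < k.+1) f a * h b * (g ^+ (a + b) : fps) k.
  transitivity (\sum_(i < k.+1) \sum_(a < k.+1) \sum_(b < k.+1)
     f a * h b * ((g ^+ a : fps) i * (g ^+ b : fps) (k - i)%N)).
    apply: eq_bigr => i _; rewrite !(@fcompE _ _ k.+1) // ?ltnS ?leq_subr //.
    rewrite big_distrlr /=; apply: eq_bigr => a _; apply: eq_bigr => b _; ring.
  rewrite exchange_big; apply: eq_bigr => a _.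
  rewrite exchange_big; apply: eq_bigr => b _.
  by rewrite -mulr_sumr exprD fmulE.
transitivity (\sum_(j < k.+1) \sum_(a < k.+1 | (a <= j)%N)
    f a * h (j - a)%N * (g ^+ j : fps) k).
  apply: eq_bigr => j _; rewrite fmulE mulr_suml.
  by rewrite (big_ord_widen k.+1 (fun a => f a * h (j - a)%N * (g ^+ j : fps) k)).
rewrite (exchange_big_dep predT) //=; apply: eq_bigr => a _.
transitivity (\sum_(b < k.+1 | (a + b <= k)%N) f a * h b * (g ^+ (a + b) : fps) k).
  rewrite (reindex_onto (fun b : 'I_k.+1 => inord (a + b)) (fun j => inord (j - a))) /=.
    apply: eq_big => [b|b].
      case: (leqP (a + b) k) => [le|lt].
        rewrite inordK // leq_addr /=.
        by apply/eqP/val_inj; rewrite /= addKn inord_val.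
      (* For [a + b > k], [inord] returns some default [c <= k]; whatever it is, [c - a] cannot be
         [b]. *)
      apply/negP => /andP[_ /eqP/(congr1 val)/=].
      have : (@inord k (a + b) <= k)%N by rewrite -ltnS.
      set c : nat := inord (a + b) => lec.
      have := ltn_ord b; have := ltn_ord a.
      by rewrite inordK; lia.
    move=> /andP[le1 /eqP/(congr1 val)/=].
    have lec := ltn_ord (@inord k (a + b)).
    rewrite inordK; last by lia.
    move=> e; have -> : nat_of_ord (@inord k (a + b)) = (a + b)%N by lia.
    by rewrite addKn.
  move=> j le; apply/val_inj; have ltj := ltn_ord j.
  have E : nat_of_ord (@inord k (j - a)) = (j - a)%N.
    by rewrite inordK // (leq_ltn_trans _ ltj) ?leq_subr.
  by rewrite /= E subnKC // inord_val.
rewrite big_mkcond; apply: eq_bigr => b _.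
by case: leqP => // lt; rewrite fexpr_eq0 // mulr0.
Qed.

Lemma fcomp1 (g : fps) : fcomp 1 g = 1.
Proof.
apply/funext => k; rewrite /fcomp big_ord_recl f1E mul1r.
by rewrite big1 ?addr0 // => i _; rewrite f1E mul0r.
Qed.

Lemma fcompXn (f g : fps) j : g 0%N = 0 -> fcomp (f ^+ j) g = fcomp f g ^+ j.
Proof.
by move=> g0; elim: j => [|j IH]; rewrite ?fcomp1 // !exprS fcompM // IH.
Qed.

Lemma fcompA (h f g : fps) : f 0%N = 0 -> g 0%N = 0 ->
  fcomp (fcomp h f) g = fcomp h (fcomp f g).
Proof.
move=> f0 g0; have fg0 : fcomp f g 0%N = 0 by rewrite fcomp0.
apply/funext => k.
rewrite [LHS](@fcompE _ _ k.+1) // [RHS](@fcompE _ _ k.+1) //.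
transitivity (\sum_(j < k.+1) \sum_(i < k.+1) h i * (f ^+ i) j * (g ^+ j : fps) k).
  by apply: eq_bigr => j _; rewrite (@fcompE _ _ k.+1) // mulr_suml.
rewrite exchange_big; apply: eq_bigr => i _.
rewrite -fcompXn // (@fcompE _ _ k.+1) // mulr_sumr.
by apply: eq_bigr => j _; rewrite mulrA.
Qed.

(** * The derivation [x d/dx], exponentials and first-order linear equations *)

Definition theta (f : fps) : fps := fun k => k%:R * f k.

Lemma thetaD (f g : fps) : theta (f + g) = theta f + theta g.
Proof. by apply/funext => k; rewrite faddE /theta mulrDr. Qed.
Lemma thetaN (f : fps) : theta (- f) = - theta f.
Proof. by apply/funext => k; rewrite foppE /theta mulrN. Qed.
Lemma thetaB (f g : fps) : theta (f - g) = theta f - theta g.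
Proof. by rewrite thetaD thetaN. Qed.
Lemma thetaM (f g : fps) : theta (f * g) = theta f * g + f * theta g.
Proof.
apply/funext => k; rewrite faddE /theta !fmulE -big_split mulr_sumr /=.
apply: eq_bigr => i _.
have -> : k%:R = i%:R + (k - i)%:R :> rat by rewrite -natrD subnKC // -ltnS.
ring.
Qed.
Lemma theta_const c : theta (fconst c) = 0.
Proof.
by apply/funext => k; rewrite f0E /theta /fconst; case: eqP => [->|]; rewrite ?mul0r ?mulr0.
Qed.
Lemma theta1 : theta 1 = 0. Proof. exact: theta_const. Qed.
Lemma thetaX : theta fX = fX.
Proof.
by apply/funext => k; rewrite /theta /fX; case: eqP => [->|]; rewrite ?mulr1 ?mulr0.
Qed.
Lemma thetaXn (f : fps) j : theta (f ^+ j) = j%:R * f ^+ j.-1 * theta f.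
Proof.
elim: j => [|j IH]; first by rewrite theta1 !mul0r.
rewrite exprS thetaM IH -natr1 /=.
case: j {IH} => [|j] /=; first by rewrite !mulr0n; ring.
by rewrite exprS; ring.
Qed.
Lemma fexp0 (g : fps) : fexp g 0%N = 1.
Proof. by rewrite /fexp fcomp0 /expS invr1. Qed.

Lemma theta_fexp (g : fps) : g 0%N = 0 -> theta (fexp g) = theta g * fexp g.
Proof.
move=> g0; apply/funext => k; rewrite /theta fmulE.
transitivity (\sum_(j < k.+1) expS j * (theta g * g ^+ j : fps) k).
  (* One term more than necessary, so that [k.+1] terms remain after the constant one is dropped;
     then [j.+1 * expS j.+1 = expS j] shifts the index. *)
  rewrite /fexp (@fcompE _ _ k.+2) // mulr_sumr big_ord_recl.
  have -> : k%:R * (expS (@ord0 k.+1) * (g ^+ (@ord0 k.+1) : fps) k) = 0.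
    rewrite expr0 f1E; by case: eqP => [->|]; rewrite ?mul0r ?mulr0.
  rewrite add0r; apply: eq_bigr => j _.
  rewrite lift0 mulrCA -[k%:R * _]/(theta (g ^+ j.+1 : fps) k) thetaXn /=.
  rewrite -mulrA [g ^+ j * _]mulrC fmulE big_ord_recl fnatE /= subn0.
  rewrite big1 => [|i _]; last by rewrite fnatE mul0r.
  rewrite addr0 mulrA; congr (_ * _).
  rewrite /expS factS natrM invfM mulrAC mulVf ?mul1r //.
  by rewrite pnatr_eq0.
transitivity (\sum_(j < k.+1) \sum_(l < k.+1)
    theta g l * (expS j * (g ^+ j : fps) (k - l)%N)).
  apply: eq_bigr => j _; rewrite fmulE mulr_sumr; apply: eq_bigr => l _.
  by rewrite mulrCA.
rewrite exchange_big; apply: eq_bigr => l _.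
by rewrite -mulr_sumr /fexp -fcompE // ltnS leq_subr.
Qed.

(** As [h] has no constant term, the equation expresses [k.+1 * y k.+1] through earlier coefficients
    of [y]. Each equation below is solved by exhibiting a solution and invoking this. *)
Lemma linear_ode_unique (h s y z : fps) : h 0%N = 0 ->
  theta y = y * h + s -> theta z = z * h + s -> y 0%N = z 0%N -> y = z.
Proof.
move=> h0 ey ez e0; apply/funext => k; elim/ltn_ind: k => -[//|k] IH.
have E (w : fps) : theta w = w * h + s ->
    k.+1%:R * w k.+1 = \sum_(i < k.+1) w i * h (k.+1 - i)%N + s k.+1.
  move=> /(congr1 (fun f : fps => f k.+1)).
  by rewrite faddE fmulE big_ord_recr /= subnn h0 mulr0 addr0.
have /mulfI : k.+1%:R != 0 :> rat by rewrite pnatr_eq0.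
apply; rewrite !E //; congr (_ + _); apply: eq_bigr => i _.
by rewrite IH.
Qed.

Lemma theta_at0 (f : fps) : theta f 0%N = 0. Proof. exact: mul0r. Qed.

Lemma fexp_unique (g y : fps) : g 0%N = 0 ->
  theta y = y * theta g -> y 0%N = 1 -> y = fexp g.
Proof.
move=> g0 ey y0; apply: (@linear_ode_unique (theta g) 0).
- exact: theta_at0.
- by rewrite addr0.
- by rewrite addr0 theta_fexp // mulrC.
- by rewrite fexp0.
Qed.

Lemma fexpD (f g : fps) : f 0%N = 0 -> g 0%N = 0 ->
  fexp (f + g) = fexp f * fexp g.
Proof.
move=> f0 g0; symmetry; apply: fexp_unique; first by rewrite faddE f0 g0 addr0.
- by rewrite thetaM thetaD !theta_fexp //; ring.
- by rewrite fmul0E !fexp0 mulr1.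
Qed.

(** * Abel's identity and the tree function *)

(** The sum is [p m] at 1, where [p m] arises from ['X * (1 - 'X) ^+ n] by applying [x d/dx] [m]
    times. Each application lowers the order of the zero at 1 by at most one. *)
Lemma alternating_sum_powers (n m : nat) : (m < n)%N ->
  \sum_(j < n.+1) (-1) ^+ j * 'C(n, j)%:R * j.+1%:R ^+ m = 0 :> rat.
Proof.
pose p m : {poly rat} :=
  \sum_(j < n.+1) ((-1) ^+ j * 'C(n, j)%:R * j.+1%:R ^+ m) *: 'X^(j.+1).
have pS k : p k.+1 = 'X * (p k)^`().
  rewrite /p (big_morph _ (@derivD _) (@deriv0 _)) mulr_sumr; apply: eq_bigr => j _.
  rewrite derivZ derivXn /= -scaler_nat -!scalerAr scalerA -exprS.
  by rewrite exprSr mulrA.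
have p_div k : (k <= n)%N -> exists q, p k = q * (1 - 'X) ^+ (n - k).
  elim: k => [_|k IH lekn].
    exists 'X; rewrite subn0 exprDn mulr_sumr; apply: eq_bigr => j _.
    rewrite expr1n mul1r expr0 mulr1 [(- 'X) ^+ _]exprNn -mul_polyC polyCM polyC_exp polyCN.
    rewrite polyC_natr exprS; ring.
  have [q Eq] := IH (ltnW lekn).
  exists ('X * (q^`() * (1 - 'X) - q *+ (n - k))).
  rewrite pS Eq derivM deriv_exp derivB derivC derivX sub0r.
  have -> : (n - k = (n - k.+1).+1)%N by rewrite subnSK.
  rewrite /= exprS; ring.
move=> ltmn; have [q Eq] := p_div m (ltnW ltmn).
transitivity (p m).[1].
  rewrite horner_sum; apply: eq_bigr => j _.
  by rewrite hornerZ hornerXn expr1n mulr1.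
rewrite Eq hornerM horner_exp !hornerE subrr expr0n subn_eq0 leqNgt ltmn.
by rewrite mulr0.
Qed.

Lemma poly_deriv_eq (p q : {poly rat}) (a : rat) :
  p^`() = q^`() -> p.[a] = q.[a] -> p = q.
Proof.
move=> e ea; apply/eqP; rewrite -subr_eq0; apply/eqP.
set r := p - q; have r' : r^`() = 0 by rewrite derivB e subrr.
have rC : r = (r`_0)%:P.
  apply/polyP => -[|i]; rewrite coefC //=.
  have /eqP : (r^`())`_i = 0 by rewrite r' coef0.
  by rewrite coef_deriv mulrn_eq0 /= => /eqP.
have : r.[a] = 0 by rewrite hornerD hornerN ea subrr.
by rewrite rC hornerC => ->.
Qed.

(* Abel's identity at [x = 1]; [j.+1 ^ j.-1] is [(1 + j)^(j - 1)], which is 1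
   for [j = 0]. *)
Lemma abel (n : nat) :
  \sum_(j < n.+1) ('C(n, j) * j.+1 ^ j.-1)%:R *: ('X - j%:R%:P) ^+ (n - j)
  = ('X + 1) ^+ n :> {poly rat}.
Proof.
elim: n => [|n IH]; first by rewrite big_ord1 /= expr0 scale1r.
(* The derivatives agree by induction. At -1 the factor [(-1 - j) ^+ (n.+1 - j)] merges with
   [j.+1 ^ j.-1] into a signed [j.+1 ^ n], and the alternating sum of these powers vanishes. *)
apply: (@poly_deriv_eq _ _ (-1)).
  rewrite deriv_exp derivD derivX derivC addr0 mul1r /= -IH (big_morph _ (@derivD _) (@deriv0 _)).
  rewrite big_ord_recr /= subnn expr0 derivZ derivC scaler0 addr0.
  rewrite -sumrMnl; apply: eq_bigr => j _.
  rewrite derivZ deriv_exp derivB derivX derivC subr0 mul1r.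
  have le : (j <= n)%N by rewrite -ltnS.
  rewrite subSn //= scalerMnr -!scaler_nat !scalerA -!natrM; congr (_%:R *: _).
  have := mul_bin_down n.+1 j; rewrite subSn //=; nia.
rewrite horner_sum horner_exp !hornerE addNr expr0n /=.
rewrite -[RHS](mulr0 ((-1) ^+ n.+1)) -[in RHS](alternating_sum_powers (ltnSn n)).
rewrite mulr_sumr; apply: eq_bigr => j _.
rewrite hornerZ horner_exp !hornerE.
have le : (j <= n.+1)%N by rewrite -ltnS.
have -> : -1 - j%:R = - j.+1%:R :> rat by rewrite -natr1 opprD addrC.
rewrite [(- j.+1%:R) ^+ _]exprNn natrM natrX.
have sgn : (-1) ^+ n.+1 * (-1) ^+ j = (-1) ^+ (n.+1 - j) :> rat.
  by rewrite -{1}(subnK le) exprD -mulrA -expr2 sqrr_sign mulr1.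
transitivity ((-1) ^+ (n.+1 - j) * 'C(n.+1, j)%:R * j.+1%:R ^+ n : rat);
  last by rewrite -sgn.
case: (nat_of_ord j) le => [|i] le /=; first by rewrite !expr1n; ring.
have -> : i.+2%:R ^+ n = i.+2%:R ^+ (n.+1 - i.+1) * i.+2%:R ^+ i :> rat.
  by rewrite -exprD; congr (_ ^+ _); lia.
ring.
Qed.

(** With [E = Tser / x], the equation [theta E = E * theta Tser], which characterises [fexp Tser],
    is coefficientwise Abel's identity at ['X = k]. *)
Lemma Tser_fixpoint : Tser = fX * fexp Tser.
Proof.
pose E : fps := fun k => (k.+1 ^ k.-1)%:R / k`!%:R.
have TE : Tser = fX * E.
  apply/funext => -[|k]; first by rewrite fXmul0.
  rewrite fXmulS /Tser /E /= factS natrM invfM.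
  case: k => [|k] /=; first by rewrite invr1 !mulr1.
  rewrite expnS natrM.
  by field; rewrite -natrD !pnatr_eq0 -lt0n fact_gt0.
rewrite {1}TE; congr (_ * _); apply: fexp_unique => //.
apply/funext => k; rewrite fmulE big_ord_recr /= subnn theta_at0 mulr0 addr0.
have [->|k0] := posnP k; first by rewrite theta_at0 big_ord0.
(* The term [j = k] of Abel's sum contains [0 ^ 0 = 1], whereas [theta Tser] vanishes at 0; it is
   moved to the other side, where [k.+1 ^ k - k.+1 ^ k.-1 = k * k.+1 ^ k.-1]. *)
have := congr1 (fun p : {poly rat} => p.[k%:R] / k`!%:R) (abel k).
rewrite horner_exp !hornerE horner_sum big_ord_recr /= subnn expr0.
rewrite hornerZ hornerC mulr1 binn mul1n mulrDl.
move/(canRL (addrK _)) => e.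
transitivity (((k%:R + 1) ^+ k - (k.+1 ^ k.-1)%:R) / k`!%:R : rat).
  rewrite natr1 -natrX /theta /E; case: k k0 {e} => // k _ /=.
  by rewrite expnS natrM -[in X in X - _]natr1; ring.
rewrite mulrBl -e mulr_suml; apply: eq_bigr => j _.
have ltj := ltn_ord j.
rewrite hornerZ horner_exp !hornerE -natrB ?(ltnW ltj) //.
rewrite /E /theta /Tser.
have := bin_fact (ltnW ltj) => /(congr1 (fun i : nat => i%:R : rat)).
rewrite !natrM => <-.
case: (k - j)%N (subn_gt0 j k) => [|d _]; first by rewrite ltj.
rewrite [d.+1.-1]/= !natrX [d.+1%:R ^+ d.+1]exprS.
move: (fact_gt0 d.+1) (fact_gt0 j) (bin_gt0 k j).
rewrite (ltnW ltj); move: (d.+1)`! (j`!) 'C(k, j) => F1 F2 F3 h1 h2 h3.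
rewrite /=; by field; rewrite !pnatr_eq0 -!lt0n h1 h2 h3.
Qed.

(** * Functional equations and the generating functions *)

Definition eq_upto N (f g : fps) := forall k, (k < N)%N -> f k = g k.

Lemma eq_upto_mul N (f f' g g' : fps) :
  eq_upto N f f' -> eq_upto N g g' -> eq_upto N (f * g) (f' * g').
Proof.
move=> ef eg k ltkN; rewrite !fmulE; apply: eq_bigr => i _.
have lei : (i <= k)%N by rewrite -ltnS.
by rewrite ef ?eg // (leq_ltn_trans _ ltkN) // leq_subr.
Qed.

Lemma eq_upto_mulX N (f g : fps) :
  eq_upto N f g -> eq_upto N.+1 (fX * f) (fX * g).
Proof. by move=> e -[|k] ltk; rewrite ?fXmul0 // !fXmulS e. Qed.

Lemma eq_upto_exp N (f g : fps) j : eq_upto N f g -> eq_upto N (f ^+ j) (g ^+ j).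
Proof. by move=> e; elim: j => // j IH; rewrite !exprS; apply: eq_upto_mul. Qed.

Lemma eq_upto_comp N (h f g : fps) :
  eq_upto N f g -> eq_upto N (fcomp h f) (fcomp h g).
Proof.
move=> e k ltk; rewrite /fcomp; apply: eq_bigr => j _.
by rewrite !fpowR (eq_upto_exp j e).
Qed.

Lemma eq_upto_all (f g : fps) :
  (forall N, eq_upto N f g -> eq_upto N.+1 f g) -> f = g.
Proof.
move=> step; apply/funext => k; suff: eq_upto k.+1 f g by apply.
by elim: k.+1 => // N; apply: step.
Qed.

(** Multiplication by [z], which has no constant term, gains a coefficient: [z * fexp y] up to order
    [N] depends only on [y] below order [N]. *)
Lemma fexp_fixpoint_unique (z y y' : fps) : z 0%N = 0 ->
  y = z * fexp y -> y' = z * fexp y' -> y = y'.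
Proof.
move=> z0 ey ey'; apply: eq_upto_all => N e k; rewrite ltnS => lek.
rewrite ey ey' !fmulE big_ord_recl [RHS]big_ord_recl z0 !mul0r; congr (_ + _).
apply: eq_bigr => i _; congr (_ * _); apply: (eq_upto_comp _ e).
by rewrite lift0 (leq_trans _ lek) // ltn_subrL; case: k i {lek} => // [[]].
Qed.

Lemma Tser_comp (z : fps) :
  z 0%N = 0 -> fcomp Tser z = z * fexp (fcomp Tser z).
Proof.
by move=> z0; rewrite {1}Tser_fixpoint fcompM // fcompX // /fexp fcompA.
Qed.

Lemma U_equationR (U : fps) : U_equation U =
  (fX * (U * fexp U) =
   fcomp Tser (fX ^+ 2 * fexp (2%:R * U)) * (fexp (fX * fexp U) - 1)).
Proof. by rewrite /U_equation fscaleR fconst_nat fpowR. Qed.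

Lemma Fvc_formulaR (U : fps) : Fvc_formula U =
  (1 - U) * (fX * fexp U) - U * fcomp Tser (fX ^+ 2 * fexp (2%:R * U))
  + (U - fconst (1 / 2) * U ^+ 2).
Proof. by rewrite /Fvc_formula !fscaleR fconst_nat !fpowR. Qed.

(** Compare coefficients of [x^(N+2)] when the solutions agree up to [x^N]. On the right the factors
    gain two and one coefficients from the powers of [x] inside them, so the values agree; on the
    left the only new coefficient is [U N.+1], multiplied by 1. *)
Lemma U_equation_unique (U U' : fps) : U 0%N = 0 -> U' 0%N = 0 ->
  U_equation U -> U_equation U' -> U = U'.
Proof.
move=> U0 U'0; rewrite !U_equationR => eU eU'; apply: eq_upto_all => N e.
case: N e => [|N] e; first by case=> [|//] _; rewrite U0.
move=> k; rewrite ltnS leq_eqVlt => /orP[/eqP->|/e //].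
have eE : eq_upto N.+1 (fexp U) (fexp U') by apply: eq_upto_comp.
have eT : eq_upto N.+3 (fcomp Tser (fX ^+ 2 * fexp (2%:R * U)))
                       (fcomp Tser (fX ^+ 2 * fexp (2%:R * U'))).
  apply: eq_upto_comp; rewrite expr2 -!mulrA.
  do 2 apply: eq_upto_mulX; apply: eq_upto_comp; exact: eq_upto_mul.
have eA : eq_upto N.+2 (fexp (fX * fexp U) - 1) (fexp (fX * fexp U') - 1).
  by move=> i lti; rewrite !faddE; congr (_ + _);
     apply: eq_upto_comp lti; apply: eq_upto_mulX.
have eqR : (fX * (U * fexp U) : fps) N.+2 = (fX * (U' * fexp U') : fps) N.+2.
  rewrite eU eU' !fmulE big_ord_recl [RHS]big_ord_recl !fcomp0 !mul0r.
  congr (_ + _); apply: eq_bigr => i _; rewrite lift0 subSS.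
  by rewrite eT ?eA ?ltnS ?leq_subr // -ltnS.
move: eqR; rewrite !fXmulS !fmulE big_ord_recr [in RHS]big_ord_recr /= subnn !fexp0 !mulr1.
suff -> : \sum_(i < N.+1) U i * fexp U (N.+1 - i)%N =
          \sum_(i < N.+1) U' i * fexp U' (N.+1 - i)%N by move/addrI.
(* The term [i = 0] involves the still unknown coefficient [N.+1] of [fexp U], but is killed by
   [U 0 = 0]. *)
rewrite big_ord_recl [RHS]big_ord_recl U0 U'0 !mul0r; congr (_ + _).
apply: eq_bigr => i _; by rewrite lift0 e ?ltnS // eE // subSS ltnS leq_subr.
Qed.

(* Classes of pairs (rooted tree, vertex cover).  In type A no minimum cover
   contains the root, in type B some do and some do not, in type C all do.  The
   suffix tells whether the cover contains the root.  Covers are minimum except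
   in class [AIn], where they have one vertex more than a minimum cover. *)
Inductive cls := AOut | AIn | BIn | BOut | CIn.

(* Joining by an edge the root of a pair of class [p] (the child) to the root of
   a pair of class [q], which stays the root, gives a pair of class [s] exactly
   for [(p, q) \in join_rule s]. *)
Definition join_rule (s : cls) : seq (cls * cls) :=
  match s with
  | AOut => [:: (BIn, AOut); (CIn, AOut)]
  | AIn => [:: (BIn, AIn); (BOut, AIn); (CIn, AIn)]
  | BIn => [:: (AOut, AIn); (BIn, BIn); (BOut, BIn); (CIn, BIn)]
  | BOut => [:: (AIn, AOut); (BIn, BOut); (CIn, BOut)]
  | CIn => [:: (AOut, BIn); (AOut, CIn); (BIn, CIn); (BOut, CIn); (CIn, CIn)]
  end.

Definition join (R : pzSemiRingType) (w1 w2 : cls -> R) (s : cls) : R :=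
  \sum_(pq <- join_rule s) w1 pq.1 * w2 pq.2.

(** The one-vertex tree has type A: its minimum cover is empty, and the cover formed by the root is
    one larger. *)
Definition leaf (R : pzSemiRingType) (s : cls) : R :=
  match s with AOut | AIn => 1 | _ => 0 end.

Definition min_total (R : pzSemiRingType) (w : cls -> R) : R :=
  w AOut + w BIn + w BOut + w CIn.

Lemma theta_X (f : fps) k : theta (fX * f) k.+1 = k.+1%:R * f k.
Proof. by rewrite /theta fXmulS. Qed.

(** * Solving the differential system of the classes *)

Section Series.
Variable g : nat -> cls -> rat.
Hypothesis g1 : forall s, g 1 s = leaf rat s.
Hypothesis gS : forall n s, g n.+2 s = \sum_(k < n.+1)
  'C(n, k)%:R * k.+1%:R * join (g k.+1) (g (n - k).+1) s.

(** [g n s] counts pairs on [n] labels with a fixed root, and the root carries no label in [a s].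
    Hence [fX * a s] is the exponential generating function of the pairs of class [s] with an
    arbitrary root. *)
Let a s : fps := fun k => g k.+1 s / k`!%:R.
Let A := fX * a AOut.
Let b := fX * a AIn.
Let U := fX * a BIn + fX * a CIn.
Let W := A * b.

Lemma a_at0 s : a s 0%N = leaf rat s.
Proof. by rewrite /a g1 divr1. Qed.

(** The binomial coefficient is absorbed by the factorials, and the factor [k.+1], the number of
    choices for the child, by [theta] on [fX * a pq.1]. *)
Lemma theta_a s :
  theta (a s) = \sum_(pq <- join_rule s) theta (fX * a pq.1) * a pq.2.
Proof.
apply/funext => -[|n].
  rewrite theta_at0 fsumE big1 // => pq _.
  by rewrite fmul0E theta_at0 mul0r.
rewrite fsumE {1}/theta {1}/a gS.
transitivity (\sum_(k < n.+1) \sum_(pq <- join_rule s)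
   k.+1%:R * a pq.1 k * a pq.2 (n - k)%N); last first.
  rewrite exchange_big; apply: eq_bigr => pq _.
  rewrite fmulE [RHS]big_ord_recl theta_at0 mul0r add0r; apply: eq_bigr => k _.
  by rewrite lift0 theta_X subSS.
rewrite mulrA mulrAC mulr_sumr; apply: eq_bigr => k _.
rewrite /join mulr_sumr mulr_sumr; apply: eq_bigr => pq _.
have lek : (k <= n)%N by rewrite -ltnS.
have := bin_fact lek => /(congr1 (fun i : nat => i%:R : rat)).
rewrite /a factS !natrM => <-.
move: (fact_gt0 k) (fact_gt0 (n - k)) (bin_gt0 n k); rewrite lek.
move: (k`!) ((n - k)`!) 'C(n, k) => F1 F2 F3 h1 h2 h3.
have : n.+1%:R != 0 :> rat by rewrite pnatr_eq0.
by move: (n.+1%:R) => F0 h0; field; rewrite h0 !pnatr_eq0 -!lt0n h1 h2 h3.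
Qed.

Lemma U0 : U 0%N = 0.
Proof. by rewrite /U faddE !fXmul0 addr0. Qed.
Lemma A_at0 : A 0%N = 0. Proof. exact: fXmul0. Qed.

Lemma aAOutE : a AOut = fexp U.
Proof.
apply: fexp_unique; rewrite ?U0 ?a_at0 //.
by rewrite theta_a /= !big_cons big_nil /U thetaD; ring.
Qed.

(** Variation of constants: the source term comes from the single branch of type A, whose root must
    be in the cover because the root is not. *)
Lemma aBOutE : a BOut = a AOut * b.
Proof.
apply: (@linear_ode_unique (theta U) (a AOut * theta b)).
- exact: theta_at0.
- by rewrite theta_a !big_cons big_nil /= /b /U thetaD; ring.
- rewrite thetaM aAOutE theta_fexp ?U0 //; ring.
- by rewrite /b fmul0E !a_at0 fXmul0 mulr0.
Qed.

Lemma theta_aAIn : theta (a AIn) = a AIn * theta (U + W).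
Proof.
rewrite theta_a !big_cons big_nil /= /W /A /U.
have -> : fX * a AOut * b = fX * a BOut by rewrite aBOutE; ring.
by rewrite !thetaD; ring.
Qed.

Lemma UW0 : (U + W) 0%N = 0.
Proof. by rewrite faddE U0 /W fmul0E A_at0 mul0r add0r. Qed.

Lemma aAInE : a AIn = fexp (U + W).
Proof. by apply: fexp_unique; rewrite ?UW0 ?a_at0 // theta_aAIn. Qed.

Lemma XaBOut : fX * a BOut = W.
Proof. by rewrite aBOutE /W /A; ring. Qed.

Lemma aBInE : a BIn = a AIn * A.
Proof.
apply: (@linear_ode_unique (theta (U + W)) (a AIn * theta A)).
- exact: theta_at0.
- rewrite theta_a !big_cons big_nil /= XaBOut /A /U !thetaD; ring.
- by rewrite thetaM theta_aAIn; ring.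
- by rewrite fmul0E !a_at0 A_at0 mulr0.
Qed.

(** The last factor accounts for two or more branches of type A, just as [A] in [aBInE] accounts for
    exactly one. *)
Lemma aCInE : a CIn = a AIn * (fexp A - 1 - A).
Proof.
apply: (@linear_ode_unique (theta (A + U + W)) (a BIn * theta A)).
- exact: theta_at0.
- rewrite theta_a !big_cons big_nil /= -XaBOut /A /U !thetaD; ring.
- rewrite aBInE thetaM theta_aAIn !thetaB theta1 theta_fexp ?A_at0 // !thetaD; ring.
- by rewrite fmul0E !a_at0 !faddE !foppE fexp0 A_at0 f1E /=; ring.
Qed.

Lemma U_b : U = b * (fexp A - 1).
Proof. by rewrite /U aBInE aCInE /b; ring. Qed.

Lemma A_U : A = fX * fexp U. Proof. by rewrite /A aAOutE. Qed.

(** [W = A * b = (x exp(U)) (x exp(U + W))], so [W] solves [W = z exp(W)] with [z = x^2 exp(2U)], as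
    does [T(z)]. *)
Lemma W_Tser : fcomp Tser (fX ^+ 2 * fexp (2%:R * U)) = W.
Proof.
have z0 : (fX ^+ 2 * fexp (2%:R * U) : fps) 0%N = 0.
  by rewrite expr2 -mulrA fXmul0.
apply: (fexp_fixpoint_unique z0); first exact: Tser_comp.
have W0 : W 0%N = 0 by rewrite /W fmul0E A_at0 mul0r.
have -> : 2%:R * U = U + U by ring.
rewrite {1}/W {1}A_U /b aAInE (fexpD U0 U0) (fexpD U0 W0); ring.
Qed.

Lemma series_U_equation : U_equation U.
Proof.
by rewrite U_equationR W_Tser -A_U [in RHS]/W -mulrA -U_b A_U; ring.
Qed.

Lemma theta_Fvc_formula :
  theta (Fvc_formula U) = A + U + W.
Proof.
have eA : theta A = A * (1 + theta U).
  by rewrite A_U thetaM thetaX theta_fexp ?U0 //; ring.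
have eb : theta b = b * (1 + theta U + theta W).
  by rewrite /b thetaM thetaX theta_aAIn thetaD; ring.
have eW : theta W = theta A * b + A * theta b by rewrite thetaM.
(* The exponential is eliminated by [b * fexp A = U + b], which leaves only polynomial relations
   between [A], [U], [W] and their derivatives. *)
have eU : theta U = U * (1 + theta U + theta W) + (U * A + W) * (1 + theta U).
  rewrite {1}U_b thetaM thetaB theta1 subr0 theta_fexp ?A_at0 // eA eb.
  have -> : b * (1 + theta U + theta W) * (fexp A - 1) =
            U * (1 + theta U + theta W) by rewrite mulrAC -U_b.
  have -> : U * A = b * fexp A * A - W by rewrite {1}U_b /W; ring.
  ring.
(* In the derivative of the formula [theta W] occurs only in this product; after substitution all
   terms in [theta U] cancel. *)
have eUW : U * theta W =
    theta U - U * (1 + theta U) - (U * A + W) * (1 + theta U).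
  by rewrite {1}eU; ring.
rewrite Fvc_formulaR W_Tser -A_U.
have half : fconst (1 / 2) * 2%:R = 1 :> fps.
  rewrite -fconst_nat -fscaleR; apply/funext => k.
  by rewrite f1E /fscale /fconst; case: eqP => _ //=; rewrite mulr0.
move: eA eUW half; move: (A) (U) (W) => A' U' W' eA eUW half.
rewrite !(thetaB, thetaD, thetaM) theta1 theta_const eA.
rewrite eUW.
have -> : 0 * (U' * U') + fconst (1 / 2) * (theta U' * U' + U' * theta U') =
  U' * theta U' by rewrite -[RHS]mul1r -half; ring.
ring.
Qed.

Lemma series_total k :
  (A + U + W) k.+1 = min_total (g k.+1) / k`!%:R.
Proof.
by rewrite -XaBOut /U /A !faddE !fXmulS /a /min_total; ring.
Qed.

Lemma Fvc_formula0 : Fvc_formula U 0%N = 0.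
Proof.
by rewrite Fvc_formulaR W_Tser -A_U !faddE !foppE expr2 !fmul0E U0 A_at0; ring.
Qed.

End Series.

Theorem series_solution (g : nat -> cls -> rat) :
    (forall s, g 1 s = leaf rat s) ->
    (forall n s, g n.+2 s = \sum_(k < n.+1)
      'C(n, k)%:R * k.+1%:R * join (g k.+1) (g (n - k).+1) s) ->
  exists U : fps, [/\ U 0%N = 0, U_equation U & forall k,
    Fvc_formula U k = if k == 0%N then 0 else min_total (g k) / k`!%:R].
Proof.
move=> g1 gS; eexists; split; [exact: U0 | exact: series_U_equation g1 gS |].
case=> [|k]; first exact: Fvc_formula0 g1 gS.
have := congr1 (fun f : fps => f k.+1) (theta_Fvc_formula g1 gS).
rewrite /= (series_total g1 gS) factS natrM invfM mulrCA => <-.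
by rewrite /theta mulKf // pnatr_eq0.
Qed.

(** * Leading terms of independence polynomials *)

Lemma size_addp_pos (p q : {poly rat}) : 0 < lead_coef p -> 0 < lead_coef q ->
  size (p + q) = maxn (size p) (size q) /\
  lead_coef (p + q) =
    if (size p < size q)%N then lead_coef q
    else if (size q < size p)%N then lead_coef p
    else lead_coef p + lead_coef q.
Proof.
move=> hp hq; case: ltngtP => lt.
- by rewrite addrC size_polyDl // lead_coefDl // (maxn_idPr (ltnW lt)).
- by rewrite size_polyDl // lead_coefDl // (maxn_idPl (ltnW lt)).
have E : (p + q)`_(size p).-1 = lead_coef p + lead_coef q.
  by rewrite coefD !lead_coefE lt.
have n0 : lead_coef p + lead_coef q != 0 by rewrite gt_eqF ?addr_gt0.
have sz : size (p + q) = size p.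
  apply/eqP; rewrite eqn_leq (leq_trans (size_polyD _ _)) ?lt ?maxnn //=.
  rewrite -lt; apply: contraNT n0; rewrite -ltnNge => lt'.
  rewrite -E; apply/eqP/leq_sizeP; last exact: leqnn.
  by rewrite -ltnS prednK // -?(size_poly_gt0) ?(leq_ltn_trans _ lt').
by split; rewrite ?sz // lead_coefE sz E.
Qed.

(* [P.1] and [P.2] stand for the generating polynomials, by cardinality, of the
   independent sets that avoid the root and that contain it.  Minimum vertex
   covers are the complements of maximum independent sets, which the leading
   coefficients count; these multiply, since there is no cancellation. *)
Definition valid_pair (P : {poly rat} * {poly rat}) :=
  [/\ 0 < lead_coef P.1, 0 < lead_coef P.2 & (size P.2 <= (size P.1).+1)%N].

(** [C] is the child and [M] the tree that keeps its root; the new edge forbids only the sets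
    containing both roots. *)
Definition join_pair (C M : {poly rat} * {poly rat}) :=
  (M.1 * (C.1 + C.2), M.2 * C.1).

(** Comparing sizes compares the largest independent sets through the root with those avoiding it:
    one more is type A, equal is type B, fewer is type C. A cover contains the root when its
    complement avoids it, so the [In] classes read [P.1] and the [Out] classes [P.2]; in type A the
    sets counted by [P.1] are one short of maximum. *)
Definition weight (P : {poly rat} * {poly rat}) (s : cls) : rat :=
  match s with
  | AOut => if size P.2 == (size P.1).+1 then lead_coef P.2 else 0
  | AIn => if size P.2 == (size P.1).+1 then lead_coef P.1 else 0
  | BIn => if size P.2 == size P.1 then lead_coef P.1 else 0
  | BOut => if size P.2 == size P.1 then lead_coef P.2 else 0
  | CIn => if (size P.2 < size P.1)%N then lead_coef P.1 else 0
  end.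

Lemma min_total_weight P :
  valid_pair P -> min_total (weight P) = lead_coef (P.1 + P.2).
Proof.
case=> h1 h2 le; have [_ ->] := size_addp_pos h1 h2.
rewrite /min_total /weight.
case: (ltngtP (size P.1) (size P.2)) => [lt|lt|e].
- have /eqP-> : size P.2 == (size P.1).+1 by rewrite eqn_leq le lt.
  by rewrite eqxx !addr0.
- by rewrite ltn_eqF ?add0r // ltnS ltnW.
- by rewrite e ltn_eqF // add0r addr0.
Qed.

Lemma lead_gt0_size (p : {poly rat}) : 0 < lead_coef p -> (0 < size p)%N.
Proof. by move=> h; rewrite size_poly_gt0 -lead_coef_eq0 gt_eqF. Qed.

Lemma size_mulp_pos (p q : {poly rat}) : 0 < lead_coef p -> 0 < lead_coef q ->
  size (p * q) = (size p + size q).-1.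
Proof.
by move=> hp hq; rewrite size_mul // -size_poly_gt0 lead_gt0_size.
Qed.

Lemma valid_join C M :
  valid_pair C -> valid_pair M -> valid_pair (join_pair C M).
Proof.
move=> [c1 c2 cs] [m1 m2 ms]; have [ss ls] := size_addp_pos c1 c2.
have l0 : 0 < lead_coef (C.1 + C.2).
  by rewrite ls; do 2 case: ifP => // _; rewrite addr_gt0.
split; rewrite /= ?lead_coefM ?mulr_gt0 // !size_mulp_pos // ss.
have := lead_gt0_size c1; have := lead_gt0_size m1.
have := lead_gt0_size c2; have := lead_gt0_size m2.
lia.
Qed.

Lemma weight_join C M s : valid_pair C -> valid_pair M ->
  weight (join_pair C M) s = join (weight C) (weight M) s.
Proof.
move=> [c1 c2 cs] [m1 m2 ms]; have [ss ls] := size_addp_pos c1 c2.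
have l0 : 0 < lead_coef (C.1 + C.2).
  by rewrite ls; do 2 case: ifP => // _; rewrite addr_gt0.
rewrite /join /weight /join_pair /= !size_mulp_pos // !lead_coefM ls ss.
move: (lead_gt0_size c1) (lead_gt0_size m1) (lead_gt0_size c2) (lead_gt0_size m2).
move: (lead_coef C.1) (lead_coef C.2) (lead_coef M.1) (lead_coef M.2)
  {c1 c2 m1 m2 l0 ss ls} => lC1 lC2 lM1 lM2.
move: cs ms; move: (size C.1) (size C.2) (size M.1) (size M.2) => a b c d.
move=> h1 h2 h3 h4 h5 h6.
have typ x y : (y <= x.+1)%N -> [\/ y = x.+1, y = x | (y < x)%N].
  move=> h; case: (ltngtP y x) => h'; [exact: Or33| |exact: Or32].
  by apply: Or31; lia.
(* The nine combinations of types of child and main tree, each checked against the five rows of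
   [join_rule]. *)
by case: (typ _ _ h1) => [eb|eb|eb]; case: (typ _ _ h2) => [ed|ed|ed];
  subst; case: s; rewrite !big_cons big_nil /=;
  repeat (case: ifP; try (by lia)); intros; ring.
Qed.

(** * Decomposition of labeled trees *)

(** Applied to maps that collapse one side of an edge to a vertex, under which a step may become
    trivial. *)
Lemma map_connect (T T' : finType) (e : rel T) (e' : rel T') (f : T -> T') x y :
    (forall u v, e u v -> connect e' (f u) (f v)) ->
  connect e x y -> connect e' (f x) (f y).
Proof.
move=> He /connectP[p]; elim: p x => [|z p IH] x /=; first by move=> _ ->.
by case/andP=> /He exz /IH h /h; apply: connect_trans.
Qed.

Lemma connect_closed (T : finType) (e : rel T) (A : {pred T}) x y :
  (forall u v, e u v -> u \in A -> v \in A) -> connect e x y -> x \in A -> y \in A.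
Proof.
move=> He /connectP[p]; elim: p x => [|z p IH] x /=; first by move=> _ ->.
by case/andP=> /He exz /IH h /h{}h /exz.
Qed.

Lemma connect_crossing (T : finType) (e : rel T) (A : {pred T}) x y :
  connect e x y -> x \in A -> y \notin A ->
  exists u v, [/\ e u v, u \in A & v \notin A].
Proof.
move=> /connectP[p]; elim: p x => [|z p IH] x /=; first by move=> _ -> ->.
case/andP=> exz pz ly xA yA; case: (boolP (z \in A)) => zA; last by exists x, z.
exact: IH pz ly zA yA.
Qed.

Lemma set2_eq (T : finType) (x y u v : T) : [set x; y] = [set u; v] ->
  x = u /\ y = v \/ x = v /\ y = u.
Proof.
move=> e; have := set21 u v; have := set22 u v; rewrite -e !inE.
have := set21 x y; have := set22 x y; rewrite e !inE.
by do 4 (case/orP=> /eqP ?); subst; auto.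
Qed.

Section Trees.
Variable n : nat.
Implicit Types (x y r c m : 'I_n) (S : {set 'I_n}) (E : {set {set 'I_n}}).

Lemma adj_sym E : symmetric (adj E).
Proof. by move=> x y; rewrite /adj eq_sym setUC. Qed.

Lemma connect_adjC E x y : connect (adj E) x y = connect (adj E) y x.
Proof. exact/sym_connect_sym/adj_sym. Qed.

Lemma sub_adj E E' : E \subset E' -> subrel (adj E) (adj E').
Proof. by move=> /subsetP s x y /andP[xy /s]; rewrite /adj xy => ->. Qed.

Lemma sub_connect_adj E E' x y :
  E \subset E' -> connect (adj E) x y -> connect (adj E') x y.
Proof.
by move=> s; apply: connect_sub => u v /(sub_adj s) /connect1.
Qed.

(** Trees live on subsets [S] of one fixed vertex type, so that cutting and glueing need no
    relabelling. *)
Definition edges_on S E := [forall e in E, (#|e| == 2) && (e \subset S)].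

Definition bridged E :=
  [forall x, forall y, adj E x y ==> ~~ connect (adj (E :\ [set x; y])) x y].

(* Acyclicity is expressed by requiring every edge to be a bridge. *)
Definition tree_on S E :=
  [&& edges_on S E, [forall x in S, forall y in S, connect (adj E) x y]
    & bridged E].

Lemma tree_onP S E : reflect
  [/\ forall e, e \in E -> #|e| = 2 /\ e \subset S,
      {in S &, forall x y, connect (adj E) x y} &
      forall x y, adj E x y -> ~~ connect (adj (E :\ [set x; y])) x y]
  (tree_on S E).
Proof.
apply: (iffP and3P) => [[/forall_inP h1 /forall_inP h2 /forallP h3]|[h1 h2 h3]].
  split=> [e /h1/andP[/eqP-> ->] //|x y xS yS|x y].
    by have /forall_inP := h2 _ xS; apply.
  by have /forallP/(_ y)/implyP := h3 x.
split.
- by apply/forall_inP => e /h1[-> ->].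
- by apply/forall_inP => x xS; apply/forall_inP => y yS; apply: h2.
- by apply/forallP => x; apply/forallP => y; apply/implyP/h3.
Qed.

Lemma edge_card2 E S e : tree_on S E -> e \in E ->
  exists x y, [/\ x \in S, y \in S, adj E x y & e = [set x; y]].
Proof.
case/tree_onP=> h _ _ eE; have [/eqP/cards2P[x [y [xy ee]]] /subsetP es] := h e eE.
exists x, y; rewrite /adj xy -ee eE; split=> //; apply: es; rewrite ee.
  exact: set21.
exact: set22.
Qed.

Lemma tree_adjS S E x y : tree_on S E -> adj E x y -> (x \in S) * (y \in S).
Proof.
case/tree_onP=> h _ _ /andP[_ /h[_ /subsetP s]].
by split; apply: s; rewrite ?set21 ?set22.
Qed.

(** Convention: [E1] is the branch with root [c], and [E2] is the part that keeps the root [r]. *)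
Definition glue r c E1 E2 := [set r; c] |: (E1 :|: E2).

Lemma glueC r c E1 E2 : glue r c E1 E2 = glue c r E2 E1.
Proof. by rewrite /glue [E1 :|: _]setUC [[set r; c]]setUC. Qed.

Lemma adj_glue r c E1 E2 x y : adj (glue r c E1 E2) x y ->
  [\/ [set x; y] = [set r; c], adj E1 x y | adj E2 x y].
Proof.
case/andP=> xy; rewrite !inE => /or3P[/eqP|h|h]; first by constructor 1.
  by constructor 2; rewrite /adj xy.
by constructor 3; rewrite /adj xy.
Qed.

(** Collapsing everything outside [S1] to [c] turns a walk around the edge into one inside [E1]. *)
Lemma glue_bridge S1 S2 r c E1 E2 x y :
    [disjoint S1 & S2] -> r \in S2 -> c \in S1 ->
    tree_on S1 E1 -> tree_on S2 E2 -> adj E1 x y ->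
  ~~ connect (adj (glue r c E1 E2 :\ [set x; y])) x y.
Proof.
move=> dis rS cS t1 t2 axy; have [xS yS] := tree_adjS t1 axy.
have notS1 v : v \in S2 -> v \in S1 = false.
  by move=> vS; apply/negbTE; rewrite (disjointFl dis).
have [_ _ /(_ _ _ axy)] := tree_onP _ _ t1; apply: contra => con.
pose f v := if v \in S1 then v else c.
have : connect (adj (E1 :\ [set x; y])) (f x) (f y).
  apply: map_connect con => u v /andP[uv]; rewrite 2!inE => /andP[ne uvE].
  have : adj (glue r c E1 E2) u v by rewrite /adj uv.
  case/adj_glue => [e|a1|a2].
  - have -> : f u = f v; last by [].
    rewrite /f; case: (set2_eq e) => [[-> ->]|[-> ->]];
    by rewrite (notS1 r rS) cS.
  - have [uS vS] := tree_adjS t1 a1; rewrite /f uS vS.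
    by apply: connect1; rewrite /adj uv 2!inE ne; case/andP: a1.
  - by have [uS vS] := tree_adjS t2 a2; rewrite /f !notS1.
by rewrite /f xS yS.
Qed.

Lemma glue_tree S1 S2 r c E1 E2 :
    [disjoint S1 & S2] -> r \in S2 -> c \in S1 ->
    tree_on S1 E1 -> tree_on S2 E2 ->
  tree_on (S1 :|: S2) (glue r c E1 E2).
Proof.
move=> dis rS cS t1 t2.
have [h1 c1 b1] := tree_onP _ _ t1; have [h2 c2 b2] := tree_onP _ _ t2.
have notS1 v : v \in S2 -> v \in S1 = false.
  by move=> vS; apply/negbTE; rewrite (disjointFl dis).
have rc : r != c by apply: contraTneq cS => <-; rewrite notS1.
have sub1 : E1 \subset glue r c E1 E2 by rewrite /glue setUCA subsetUl.
have sub2 : E2 \subset glue r c E1 E2 by rewrite /glue setUA subsetUr.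
apply/tree_onP; split.
- move=> e; rewrite !inE => /or3P[/eqP->|/h1[-> s]|/h2[-> s]].
  + rewrite cards2 rc; split=> //; apply/subsetP => z.
    by rewrite !inE => /orP[/eqP->|/eqP->]; rewrite ?rS ?cS ?orbT.
  + by rewrite (subset_trans s) ?subsetUl.
  + by rewrite (subset_trans s) ?subsetUr.
- have con x : x \in S1 :|: S2 -> connect (adj (glue r c E1 E2)) x r.
    rewrite inE => /orP[xS|xS]; last exact/(sub_connect_adj sub2)/c2.
    apply: (connect_trans (sub_connect_adj sub1 (c1 _ _ xS cS))).
    by apply: connect1; rewrite /adj eq_sym rc /glue !inE [[set c; r]]setUC eqxx.
  move=> x y /con xr /con; rewrite connect_adjC; exact: connect_trans xr.
move=> x y /adj_glue[e|a1|a2].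
(* The new edge is a bridge because [S1] is closed under the remaining edges. *)
- have sub : glue r c E1 E2 :\ [set x; y] \subset E1 :|: E2.
    by apply/subsetP => z; rewrite e !inE; case: eqP.
  apply/negP => /(sub_connect_adj sub) con.
  have cl u v : adj (E1 :|: E2) u v -> u \in S1 -> v \in S1.
    case/andP=> uv; rewrite inE => /orP[uvE|uvE].
      have a : adj E1 u v by rewrite /adj uv.
      by have [_ ->] := tree_adjS t1 a.
    have a : adj E2 u v by rewrite /adj uv.
    by have [uS _] := tree_adjS t2 a; rewrite notS1.
  case: (set2_eq e) con => [[-> ->]|[-> ->]].
    rewrite connect_adjC => crc.
    by have := connect_closed cl crc cS; rewrite notS1.
  by move=> crc; have := connect_closed cl crc cS; rewrite notS1.
- exact: glue_bridge dis rS cS t1 t2 a1.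
- by rewrite glueC; apply: glue_bridge t2 t1 a2 => //; rewrite disjoint_sym.
Qed.

Lemma path_avoid E r c x p : r \notin x :: p ->
  path (adj E) x p -> path (adj (E :\ [set r; c])) x p.
Proof.
elim: p x => //= z p IH x rxzp /andP[/andP[xz xzE] pth].
move: rxzp; rewrite inE negb_or => /andP[rx rzp].
rewrite IH // andbT /adj xz 2!inE xzE andbT.
apply: contraNneq rx => e; have := set21 r c; rewrite -e !inE.
by case/orP=> // /eqP rz; rewrite rz mem_head in rzp.
Qed.

(** [c] is the vertex after [r] on a simple path to [m], and [S1] is the component of [c] once the
    edge from [r] to [c] is deleted. Connectedness of each part follows by collapsing the other
    one. *)
Lemma tree_split S E r m : tree_on S E -> r \in S -> m \in S -> m != r ->
  exists S1 c E1 E2, [/\ m \in S1, S1 \subset S :\ r, c \in S1,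
    tree_on S1 E1 & tree_on (S :\: S1) E2 /\ E = glue r c E1 E2].
Proof.
move=> t rS mS mr; have [h con br] := tree_onP _ _ t.
have [c [arc ccm]] : exists c, adj E r c /\
    connect (adj (E :\ [set r; c])) c m.
  have /connectP[p0 pth0 lst0] := con _ _ rS mS.
  case/shortenP: pth0 lst0 => -[|c p] /=.
    by move=> _ _ _ e; rewrite e eqxx in mr.
  case/andP=> rc pth /andP[rcp _] _ lst.
  by exists c; split=> //; apply/connectP; exists p => //; apply: path_avoid.
have [_ cS] := tree_adjS t arc.
have rcE : [set r; c] \in E by case/andP: arc.
set E' := E :\ [set r; c] in ccm *; have subE : E' \subset E by apply: subD1set.
pose S1 := [set x | connect (adj E') c x].
pose E1 := [set e in E' | e \subset S1].
pose E2 := [set e in E' | e \subset S :\: S1].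
have cS1 : c \in S1 by rewrite inE connect0.
have rS1 : r \notin S1 by rewrite inE connect_adjC br.
have adjE' u v : adj E u v -> [set u; v] = [set r; c] \/ adj E' u v.
  case/andP=> uv uvE; case: (eqVneq [set u; v] [set r; c]); first by left.
  by right; rewrite /adj uv 2!inE uvE andbT.
have S1_adj u v : adj E' u v -> (u \in S1) = (v \in S1).
  move=> a; rewrite !inE; apply/idP/idP => /connect_trans; apply; apply: connect1 => //.
  by rewrite adj_sym.
have adjS u v : adj E' u v -> (u \in S) * (v \in S).
  by move/(sub_adj subE)/(tree_adjS t).
have sub1 : E1 \subset E by apply/subsetP => e; rewrite inE => /andP[/(subsetP subE)].
have sub2 : E2 \subset E by apply/subsetP => e; rewrite inE => /andP[/(subsetP subE)].
have S1S : S1 \subset S :\ r.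
  apply/subsetP => x xS1; rewrite !inE; apply/andP; split.
    by apply: contraNneq rS1 => <-.
  move: xS1; rewrite inE => /connect_closed; apply; last exact: cS.
  by move=> u v /adjS[].
have adj1 u v : adj E' u v -> u \in S1 -> adj E1 u v.
  move=> a u1; have v1 : v \in S1 by rewrite -(S1_adj u v a).
  case/andP: a => uv uvE; rewrite /adj uv inE uvE.
  by apply/subsetP => z; rewrite in_set2 => /orP[]/eqP->.
have adj2 u v : adj E' u v -> u \notin S1 -> adj E2 u v.
  move=> a u1; have v1 : v \notin S1 by rewrite -(S1_adj u v a).
  have [uS vS] := adjS u v a; case/andP: a => uv uvE; rewrite /adj uv inE uvE.
  by apply/subsetP => z; rewrite in_set2 in_setD => /orP[]/eqP->; apply/andP.
exists S1, c, E1, E2; split=> //.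
- by rewrite inE.
- apply/tree_onP; split.
  + by move=> e; rewrite inE => /andP[/(subsetP subE)/h[-> _] ->].
  + suff cc x : x \in S1 -> connect (adj E1) c x.
      by move=> x y /cc cx /cc; apply: connect_trans; rewrite connect_adjC.
    move=> x1; pose f v := if v \in S1 then v else c.
    have : connect (adj E1) (f c) (f x).
      have : connect (adj E') c x by move: x1; rewrite inE.
      apply: map_connect => u v a; rewrite /f (S1_adj u v a).
      case: ifP => v1 //; apply: connect1; apply: adj1 => //.
      by rewrite (S1_adj u v a).
    by rewrite /f cS1 x1.
  + move=> x y /(sub_adj sub1)/br; apply: contra; apply: sub_connect_adj.
    exact: setSD.
- split.
    apply/tree_onP; split.
    + by move=> e; rewrite inE => /andP[/(subsetP subE)/h[-> _] ->].
    + suff cc x : x \in S :\: S1 -> connect (adj E2) x r.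
        by move=> x y /cc cx /cc; rewrite connect_adjC; apply: connect_trans.
      case/setDP=> xS x1; pose f v := if v \in S1 then r else v.
      have : connect (adj E2) (f x) (f r).
        apply: map_connect (con _ _ xS rS) => u v /adjE'[e|a]; rewrite /f.
          by case: (set2_eq e) => [[-> ->]|[-> ->]]; rewrite cS1 (negbTE rS1).
        rewrite (S1_adj u v a); case: ifP => v1 //.
        by apply: connect1; apply: adj2; rewrite ?(S1_adj u v a) ?v1.
      by rewrite /f (negbTE x1) (negbTE rS1).
    + move=> x y /(sub_adj sub2)/br; apply: contra; apply: sub_connect_adj.
      exact: setSD.
apply/setP => e; rewrite 3!inE; apply/idP/idP => [eE|].
  have [u [v [_ _ a ee]]] := edge_card2 t eE.
  case: (adjE' u v a) => [<-|a']; first by rewrite ee eqxx.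
  rewrite ee; case: (boolP (u \in S1)) => u1.
    by have /andP[_ ->] := adj1 u v a' u1; rewrite orbT.
  by have /andP[_ ->] := adj2 u v a' u1; rewrite !orbT.
by case/or3P=> [/eqP->|/(subsetP sub1)|/(subsetP sub2)].
Qed.

Definition splitting S r m (q : {set 'I_n} * 'I_n * {set {set 'I_n}} * {set {set 'I_n}}) :=
  let: (S1, c, E1, E2) := q in
  [&& m \in S1, S1 \subset S :\ r, c \in S1, tree_on S1 E1 & tree_on (S :\: S1) E2].

Definition glue_splitting r (q : {set 'I_n} * 'I_n * {set {set 'I_n}} * {set {set 'I_n}}) :=
  let: (S1, c, E1, E2) := q in glue r c E1 E2.

(** The only edge leaving [S1] joins [r] to [c]. If [c] and [c'] differed, then [c'] would lie
    outside [S1], and the walk from [m] to [c'] within [S1'] would have to leave [S1] through [r],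
    which is not in [S1']. Given [c], the set [S1] is the component of [m] without that edge, and
    [E1], [E2] are the edges inside the two parts. *)
Lemma splitting_inj S r m : r \in S ->
  {in [set q | splitting S r m q] &, injective (glue_splitting r)}.
Proof.
move=> rS [[[S1 c] E1] E2] [[[S1' c'] E1'] E2']; rewrite !inE /=.
case/and5P=> m1 sub1 c1 t1 t2; case/and5P=> m1' sub1' c1' t1' t2' eE.
have notr (T : {set 'I_n}) : T \subset S :\ r -> r \notin T.
  by move=> s; apply: contraTN isT => /(subsetP s); rewrite !inE eqxx.
have r1 := notr _ sub1; have r1' := notr _ sub1'.
have step1 (U : {set 'I_n}) c0 F1 F2 u v : r \notin U -> tree_on U F1 -> tree_on (S :\: U) F2 ->
    adj (glue r c0 F1 F2) u v -> [set u; v] != [set r; c0] -> u \in U -> v \in U.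
  move=> rU tU tU' /adj_glue[->|a|a]; first by rewrite eqxx.
    by have [_ ->] := tree_adjS tU a.
  by have [uU _] := tree_adjS tU' a; case/setDP: uU => _ /negbTE->.
have ec : c = c'.
  apply/eqP; apply: contraT => ncc.
  have c'1 : c' \notin S1.
    apply: contra (r1) => c'1.
    have a : adj (glue r c E1 E2) c' r.
      have ne : c' != r by apply: contraNneq r1 => <-.
      rewrite /adj ne /=.
      by rewrite eE /glue !inE [[set c'; r]]setUC eqxx.
    apply: (step1 S1 c E1 E2 c' r) => //.
    apply: contra_neq ncc => /set2_eq[[e1 e2]|[-> _]] //.
    by rewrite e1 -e2.
  have [_ con _] := tree_onP _ _ t1'.
  have [u [v [a u1 v1]]] := connect_crossing (con _ _ m1' c1') m1 c'1.
  have [u1' v1'] := tree_adjS t1' a.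
  have a' : adj (glue r c E1 E2) u v.
    by apply: sub_adj a; rewrite eE /glue setUCA subsetUl.
  case/negP: v1; apply: (step1 _ _ _ _ _ _ r1 t1 t2 a') => //.
  apply: contraTneq u1' => /set2_eq[[-> _]//|[_ e]].
  by rewrite e (negbTE r1') in v1'.
subst c'.
have comp (U : {set 'I_n}) F1 F2 : m \in U -> r \notin U -> c \in U -> tree_on U F1 ->
    tree_on (S :\: U) F2 ->
    U = [set x | connect (adj (glue r c F1 F2 :\ [set r; c])) m x].
  move=> mU rU cU tU tU'; apply/setP => x; rewrite inE; apply/idP/idP => [xU|].
    have [hU con _] := tree_onP _ _ tU.
    apply: sub_connect_adj (con _ _ mU xU); apply/subsetP => e eF.
    rewrite !inE eF orbT /= andbT; apply: contraNneq rU => ee.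
    by have [_ /subsetP] := hU _ eF; apply; rewrite ee set21.
  move/connect_closed; apply=> // u v /andP[uv]; rewrite in_setD1 => /andP[ne uvF].
  have a : adj (glue r c F1 F2) u v by rewrite /adj uv.
  exact: step1 rU tU tU' a ne.
have eS : S1 = S1'.
  rewrite [LHS](comp _ _ _ m1 r1 c1 t1 t2) eE; apply/esym.
  exact: comp m1' r1' c1' t1' t2'.
subst S1'.
have edges1 F1 F2 : tree_on S1 F1 -> tree_on (S :\: S1) F2 ->
    F1 = [set e in glue r c F1 F2 | e \subset S1].
  move=> tF tF'; apply/setP => e; rewrite inE; apply/idP/andP => [eF|[]].
    by rewrite !inE eF orbT; have [/(_ _ eF)[_ ->]] := tree_onP _ _ tF.
  rewrite !inE => /or3P[/eqP-> /subsetP/(_ _ (set21 r c))|//|eF /subsetP s].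
    by rewrite (negbTE r1).
  have [x [y [/setDP[_ xS] _ _ ee]]] := edge_card2 tF' eF.
  by rewrite s // ee set21 in xS.
have edges2 F1 F2 : tree_on S1 F1 -> tree_on (S :\: S1) F2 ->
    F2 = [set e in glue r c F1 F2 | e \subset S :\: S1].
  move=> tF tF'; apply/setP => e; rewrite inE; apply/idP/andP => [eF|[]].
    by rewrite !inE eF !orbT; have [/(_ _ eF)[_ ->]] := tree_onP _ _ tF'.
  rewrite !inE => /or3P[/eqP-> /subsetP/(_ _ (set22 r c))|eF /subsetP s|//].
    by rewrite inE c1.
  have [x [y [xS _ _ ee]]] := edge_card2 tF eF.
  have : x \in S :\: S1 by rewrite s // ee set21.
  by rewrite inE xS.
have e1 : E1 = E1'.
  by rewrite [LHS](edges1 _ _ t1 t2) eE; apply/esym/edges1.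
have e2 : E2 = E2'.
  by rewrite [LHS](edges2 _ _ t1 t2) eE; apply/esym/edges2.
by rewrite e1 e2.
Qed.

Lemma glue_splitting_image S r m : r \in S -> m \in S -> m != r ->
  glue_splitting r @: [set q | splitting S r m q] = [set E | tree_on S E].
Proof.
move=> rS mS mr; apply/setP => E; rewrite inE; apply/imsetP/idP.
  case=> [[[[S1 c] E1] E2]]; rewrite inE => /and5P[m1 sub c1 t1 t2] ->.
  have sS : S1 \subset S by apply: subset_trans sub (subD1set _ _).
  have dis : [disjoint S1 & S :\: S1]
    by rewrite disjoint_sym -setI_eq0 setDE -setIA [_ :&: S1]setIC setICr setI0.
  have r2 : r \in S :\: S1.
    rewrite inE rS andbT; apply: contraTN isT => /(subsetP sub).
    by rewrite !inE eqxx.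
  have := glue_tree dis r2 c1 t1 t2.
  suff -> : S1 :|: (S :\: S1) = S by [].
  apply/setP => x; rewrite !inE; case: (boolP (x \in S1)) => //= xS1.
  by rewrite (subsetP sS).
move=> t; have [S1 [c [E1 [E2 [m1 sub c1 t1 [t2 ->]]]]]] := tree_split t rS mS mr.
by exists (S1, c, E1, E2); rewrite // inE /= m1 sub c1 t1 t2.
Qed.

Lemma sum_trees (R : nmodType) S r m (F : {set {set 'I_n}} -> R) :
    r \in S -> m \in S -> m != r ->
  \sum_(E | tree_on S E) F E =
  \sum_(S1 : {set 'I_n} | (m \in S1) && (S1 \subset S :\ r)) \sum_(c in S1)
    \sum_(E1 | tree_on S1 E1) \sum_(E2 | tree_on (S :\: S1) E2)
      F (glue r c E1 E2).
Proof.
move=> rS mS mr.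
transitivity (\sum_(E in [set E | tree_on S E]) F E).
  by apply: eq_bigl => E; rewrite inE.
rewrite -(glue_splitting_image rS mS mr) big_imset; last exact: splitting_inj.
rewrite pair_big_dep pair_big_dep pair_big_dep /=.
apply: eq_big => [[[[S1 c] E1] E2]|[[[S1 c] E1] E2] _] //=.
by rewrite inE /= !andbA.
Qed.

Lemma tree_on1 r E : tree_on [set r] E = (E == set0).
Proof.
apply/idP/eqP => [/tree_onP[h _ _]|->].
  apply/setP => e; rewrite inE; apply/negP => /h[c2 /subset_leq_card].
  by rewrite c2 cards1.
apply/tree_onP; split=> [e|x y|x y]; rewrite ?inE //.
  by move=> /eqP-> /eqP->; apply: connect0.
by rewrite /adj inE andbF.
Qed.

(** A simple path joining the ends of an edge without using it closes up to a cycle, of length at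
    least 3 since the edge itself is excluded. Conversely a cycle without its first edge joins the
    ends of that edge. *)
Lemma is_treeE E : is_tree E <-> tree_on setT E.
Proof.
split.
  case=> /forall_inP sg con acy; apply/tree_onP; split.
  - by move=> e /sg/eqP->; rewrite subsetT.
  - by move=> x y _ _; apply: con.
  move=> x y a; apply/negP => /connectP[p0 pth0 lst0]; apply: acy.
  have /andP[xy xyE] := a.
  case/shortenP: pth0 lst0 => p pth un _ lst; exists (x :: p); split=> //.
    case: p pth lst {un} => [|z [|z' p]] //=.
      by move=> _ yx; rewrite yx eqxx in xy.
    by rewrite andbT => /andP[_]; rewrite !inE => /andP[ne _] e; rewrite e eqxx in ne.
  rewrite /cycle rcons_path -lst adj_sym a andbT.
  by apply: sub_path pth; apply/sub_adj/subD1set.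
case/tree_onP=> h con br; split.
- by apply/forall_inP => e /h[->].
- by move=> x y; apply: con; rewrite inE.
case=> -[|x [|y [|z p]]] [] //= _; rewrite !inE !negb_or.
case/and3P=> /and3P[xy xz xp] /andP[yz yp] _.
case/andP=> axy /andP[ayz pth]; have /negP := br _ _ axy; apply.
rewrite connect_adjC; apply/connectP; exists (z :: rcons p x); last first.
  by rewrite /= last_rcons.
move: pth; rewrite rcons_path => /andP[pth alast].
have := @path_avoid E x y y (z :: p); rewrite /= rcons_path.
rewrite !inE !negb_or xy xz xp ayz pth => /(_ isT isT)/andP[-> ->] /=.
case/andP: alast => ne lE; rewrite /adj ne 2!inE lE andbT.
apply/negP => /eqP/set2_eq[[e _]|[e _]].
  by move: ne; rewrite e eqxx.
have := mem_last z p; rewrite e inE => /orP[/eqP yz'|yp'].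
  by rewrite yz' eqxx in yz.
by rewrite yp' in yp.
Qed.

End Trees.

(** * Counting minimum vertex covers *)

Lemma sum_subsetsU (T : finType) (R : nmodType) (S1 S2 : {set T})
    (Q : pred {set T}) (F : {set T} -> R) : [disjoint S1 & S2] ->
  \sum_(I : {set T} | (I \subset S1 :|: S2) && Q I) F I =
  \sum_(I1 : {set T} | I1 \subset S1)
    \sum_(I2 : {set T} | (I2 \subset S2) && Q (I1 :|: I2)) F (I1 :|: I2).
Proof.
move=> dis; rewrite pair_big_dep /=.
rewrite (reindex_onto (fun p : {set T} * {set T} => p.1 :|: p.2)
           (fun I => (I :&: S1, I :&: S2))) /=; last first.
  by move=> I /andP[/setIidPl sI _]; rewrite -setIUr.
apply: eq_bigl => -[I1 I2] /=; apply/andP/and3P.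
  case=> /andP[_ QI] /eqP[e1 e2]; split=> //.
    by rewrite -e1 subsetIr.
  by rewrite -e2 subsetIr.
case=> s1 s2 QI; rewrite setUSS // QI; split=> //.
have e12 (A B : {set T}) : A \subset S1 -> B \subset S2 -> A :&: S2 = set0 /\ B :&: S1 = set0.
  move=> sA sB; split; apply/eqP; rewrite setI_eq0.
    exact: disjointWl sA dis.
  by apply: disjointWl sB _; rewrite disjoint_sym.
have [h1 h2] := e12 _ _ s1 s2.
by rewrite !setIUl h1 h2 setU0 set0U (setIidPl s1) (setIidPl s2).
Qed.

Lemma sum_subsets_card (T : finType) (R : pzSemiRingType) (A : {set T})
    (h : nat -> R) :
  \sum_(B : {set T} | B \subset A) h #|B| =
  \sum_(k < #|A|.+1) 'C(#|A|, k)%:R * h k.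
Proof.
rewrite (partition_big (fun B : {set T} => inord #|B| : 'I_#|A|.+1) predT) //=.
apply: eq_bigr => k _; rewrite -cards_draws mulr_natl -sumr_const.
have E (B : {set T}) : B \subset A -> (inord #|B| == k) = (#|B| == k).
  by move=> /subset_leq_card le; rewrite -val_eqE /= inordK.
apply: eq_big => [B|B /andP[sB]]; rewrite ?inE.
  by case sB: (B \subset A) => //=; rewrite E.
by rewrite E // => /eqP->.
Qed.

Lemma sum_subsets_mem (T : finType) (R : nmodType) (m : T) (A : {set T})
    (h : nat -> R) : m \in A ->
  \sum_(B : {set T} | (m \in B) && (B \subset A)) h #|B| =
  \sum_(B : {set T} | B \subset A :\ m) h #|B|.+1.
Proof.
move=> mA.
rewrite (reindex_onto (fun B => m |: B) (fun B => B :\ m)) /=; last first.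
  by move=> B /andP[mB _]; rewrite setD1K.
have E B : [&& m \in m |: B, m |: B \subset A & (m |: B) :\ m == B] = (B \subset A :\ m).
  rewrite setU11 subUset sub1set mA /= subsetD1; congr (_ && _).
  apply/eqP/idP => [<-|mB]; first by rewrite setD11.
  exact: setU1K.
apply: eq_big => [B|B]; first by rewrite -andbA E.
by rewrite -andbA E subsetD1 => /andP[_ mB]; rewrite cardsU1 mB.
Qed.

Lemma lead_coef_sum_card (T : finType) (P : pred {set T}) (I0 : {set T}) : P I0 ->
  lead_coef (\sum_(I | P I) 'X^#|I| : {poly rat}) =
  #|[set I | P I && [forall J, P J ==> (#|J| <= #|I|)%N]]|%:R.
Proof.
move=> P0; pose p : {poly rat} := \sum_(I | P I) 'X^#|I|.
have [M PM maxM] : exists2 M : {set T}, P M & forall J, P J -> (#|J| <= #|M|)%N.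
  by case: (arg_maxnP (fun I : {set T} => #|I|) P0) => M PM h; exists M.
have coefp j : p`_j = #|[set I | P I && (#|I| == j)]|%:R.
  rewrite coef_sum -sum1_card natr_sum /= [LHS]big_mkcond [RHS]big_mkcond /=.
  apply: eq_bigr => I _; rewrite inE coefXn eq_sym.
  by case: (P I) => //=; case: eqP.
have sz : size p = #|M|.+1.
  apply/eqP; rewrite eqn_leq; apply/andP; split.
    apply/leq_sizeP => j lt; rewrite coefp; apply/eqP.
    rewrite pnatr_eq0 cards_eq0; apply/eqP/setP => I; rewrite !inE.
    apply/negP => /andP[/maxM le /eqP e]; by rewrite e leqNgt lt in le.
  rewrite ltnNge; apply/negP => /leq_sizeP/(_ _ (leqnn _))/eqP.
  rewrite coefp pnatr_eq0 cards_eq0 => /eqP/setP/(_ M).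
  by rewrite !inE PM eqxx.
rewrite -/p lead_coefE sz coefp; congr (_%:R); apply: eq_card => I; rewrite !inE.
case PI: (P I) => //=; apply/eqP/forall_inP => [-> //|h].
by apply/eqP; rewrite eqn_leq maxM //= h.
Qed.

(** * Independent sets of trees and the quadratic recursion *)

Section Independent.
Variable n : nat.
Implicit Types (r c : 'I_n) (S I : {set 'I_n}) (E : {set {set 'I_n}}).

Definition indep E I := [forall e in E, ~~ (e \subset I)].

Definition indep_pair S E r : {poly rat} * {poly rat} :=
  (\sum_(I : {set 'I_n} | (I \subset S) && (indep E I && (r \notin I))) 'X^#|I|,
   \sum_(I : {set 'I_n} | (I \subset S) && (indep E I && (r \in I))) 'X^#|I|).

Lemma vertex_cover_indep E I : vertex_cover E (~: I) = indep E I.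
Proof.
apply: eq_forallb => e; congr (_ ==> _).
by rewrite setI_eq0 disjoints_subset setCK.
Qed.

Lemma indep_pairD S E r : (indep_pair S E r).1 + (indep_pair S E r).2 =
  \sum_(I : {set 'I_n} | (I \subset S) && indep E I) 'X^#|I|.
Proof.
rewrite [RHS](bigID (fun I => r \notin I)) /=; congr (_ + _); apply: eq_bigl => I.
  by rewrite andbA.
by rewrite negbK andbA.
Qed.

Lemma card_min_vertex_cover E r : set0 \notin E ->
  #|[set C | min_vertex_cover E C]|%:R =
  lead_coef ((indep_pair setT E r).1 + (indep_pair setT E r).2).
Proof.
move=> E0; rewrite indep_pairD.
rewrite (eq_bigl (indep E)); last by move=> I; rewrite subsetT.
have ind0 : indep E set0.
  apply/forall_inP => e eE; rewrite subset0; apply: contraNneq E0 => <-; exact: eE.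
rewrite (lead_coef_sum_card ind0); congr (_%:R).
rewrite -(card_imset _ (@setC_inj _)); apply: eq_card => I.
rewrite -[I in LHS]setCK mem_imset; last exact: setC_inj.
rewrite !inE /min_vertex_cover vertex_cover_indep; congr (_ && _).
have cC (J : {set 'I_n}) : (#|~: J| + #|J| = n)%N by rewrite addnC cardsC card_ord.
apply/forall_inP/forall_inP => h J hJ.
  have := h (~: J); rewrite vertex_cover_indep => /(_ hJ).
  have := cC J; have := cC I; lia.
have := h (~: J); rewrite -vertex_cover_indep setCK => /(_ hJ).
have := cC J; have := cC I; lia.
Qed.

Lemma indep_glue S1 S2 r c E1 E2 (I1 I2 : {set 'I_n}) :
    [disjoint S1 & S2] -> r \in S2 -> c \in S1 ->
    tree_on S1 E1 -> tree_on S2 E2 -> I1 \subset S1 -> I2 \subset S2 ->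
  indep (glue r c E1 E2) (I1 :|: I2) =
  [&& indep E1 I1, indep E2 I2 & ~~ ((c \in I1) && (r \in I2))].
Proof.
move=> dis rS cS t1 t2 s1 s2.
have notS1 v : v \in S1 -> v \in I2 = false.
  move=> v1; apply/negbTE; apply: contraL v1 => /(subsetP s2) v2.
  by rewrite (disjointFl dis).
have notS2 v : v \in S2 -> v \in I1 = false.
  by move=> v2; apply/negbTE; apply: contraL v2 => /(subsetP s1) v1; rewrite (disjointFr dis).
have [h1 _ _] := tree_onP _ _ t1; have [h2 _ _] := tree_onP _ _ t2.
have sub1 e : e \in E1 -> (e \subset I1 :|: I2) = (e \subset I1).
  move=> /h1[_ /subsetP es]; apply/subsetP/subsetP => h z ze; have := h z ze; rewrite inE.
    by rewrite notS1 ?es // orbF.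
  by move=> ->.
have sub2 e : e \in E2 -> (e \subset I1 :|: I2) = (e \subset I2).
  move=> /h2[_ /subsetP es]; apply/subsetP/subsetP => h z ze; have := h z ze; rewrite inE.
    by rewrite notS2 ?es.
  by move=> ->; rewrite orbT.
have subrc : ([set r; c] \subset I1 :|: I2) = (c \in I1) && (r \in I2).
  by rewrite subUset !sub1set !inE notS2 // (notS1 c cS) orbF andbC.
apply/forall_inP/and3P => [h|[/forall_inP i1 /forall_inP i2 irc] e].
  split.
  - by apply/forall_inP => e eE; rewrite -sub1 // h // !inE eE orbT.
  - by apply/forall_inP => e eE; rewrite -sub2 // h // !inE eE !orbT.
  - by rewrite -subrc h // !inE eqxx.
rewrite !inE => /or3P[/eqP->|eE|eE]; first by rewrite subrc.
  by rewrite sub1 // i1.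
by rewrite sub2 // i2.
Qed.

(** Once it is decided whether [r] belongs to the set, the condition of the new edge concerns the
    branch alone, and the sums factor. *)
Lemma indep_pair_glue S1 S2 r c E1 E2 :
    [disjoint S1 & S2] -> r \in S2 -> c \in S1 ->
    tree_on S1 E1 -> tree_on S2 E2 ->
  indep_pair (S1 :|: S2) (glue r c E1 E2) r =
  join_pair (indep_pair S1 E1 c) (indep_pair S2 E2 r).
Proof.
move=> dis rS cS t1 t2.
have card12 (I1 I2 : {set 'I_n}) : I1 \subset S1 -> I2 \subset S2 ->
    'X^#|I1 :|: I2| = 'X^#|I2| * 'X^#|I1| :> {poly rat}.
  move=> s1 s2; rewrite -exprD cardsU addnC.
  have -> : I1 :&: I2 = set0; last by rewrite cards0 subn0.
  by apply/eqP; rewrite setI_eq0; apply: disjointW dis.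
have rI (I1 I2 : {set 'I_n}) : I1 \subset S1 -> (r \in I1 :|: I2) = (r \in I2).
  move=> s1; rewrite inE; case: (boolP (r \in I1)) => // /(subsetP s1) r1.
  by rewrite (disjointFr dis r1) in rS.
rewrite /join_pair indep_pairD /indep_pair /=; congr (_, _).
  rewrite sum_subsetsU // mulrC big_distrlr /= [LHS]pair_big_dep [RHS]pair_big_dep.
  apply: eq_big => [[I1 I2]|[I1 I2]] /=.
    case s1: (I1 \subset S1) => //=; case s2: (I2 \subset S2); rewrite ?andbF //=.
    rewrite (indep_glue dis) // rI //.
    by case: (r \in I2); rewrite ?andbF ?andbT //= andbT andbC.
  by case/and3P=> s1 s2 _; rewrite card12 // mulrC.
rewrite sum_subsetsU // mulrC big_distrlr /= [LHS]pair_big_dep [RHS]pair_big_dep.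
apply: eq_big => [[I1 I2]|[I1 I2]] /=.
  case s1: (I1 \subset S1) => //=; case s2: (I2 \subset S2); rewrite ?andbF //=.
  rewrite (indep_glue dis) // rI //.
  by case: (r \in I2); case: (c \in I1); rewrite ?andbF ?andbT //= andbC.
by case/and3P=> s1 s2 _; rewrite card12 // mulrC.
Qed.

Lemma indep_pair1 r : indep_pair [set r] set0 r = (1, 'X).
Proof.
have i0 I : indep set0 I by apply/forall_inP => e; rewrite inE.
rewrite /indep_pair; congr (_, _).
  rewrite (big_pred1 set0) ?cards0 // => I; rewrite i0 /= subset1.
  case: eqP => [->|_] /=; first by rewrite set11 -subset0 sub1set inE.
  by case: eqP => // ->; rewrite inE.
rewrite (big_pred1 [set r]) ?cards1 // => I; rewrite i0 /= subset1.
case: eqP => [->|_] /=; first by rewrite set11.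
by case: eqP => // ->; rewrite inE.
Qed.

Lemma set_case S r : r \in S -> S = [set r] \/ exists2 m, m \in S & m != r.
Proof.
move=> rS; have [e|[m]] := set_0Vmem (S :\ r).
  by left; rewrite -(setD1K rS) e setU0.
by rewrite !inE => /andP[mr mS]; right; exists m.
Qed.

Lemma split_facts S S1 r m : r \in S -> m \in S1 -> S1 \subset S :\ r ->
  [/\ (#|S1| < #|S|)%N, (#|S :\: S1| < #|S|)%N, r \in S :\: S1,
      [disjoint S1 & S :\: S1] & S1 :|: (S :\: S1) = S].
Proof.
move=> rS m1 sub; have sS := subset_trans sub (subD1set _ _).
have r1 : r \notin S1 by apply: contraTN isT => /(subsetP sub); rewrite !inE eqxx.
split.
- by apply: proper_card; apply/properP; split=> //; exists r.
- apply: proper_card; apply/properP; split; first exact: subsetDl.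
  by exists m; rewrite ?inE ?m1 // (subsetP sS).
- by rewrite inE r1.
- by rewrite -setI_eq0 setDE setICA setICr setI0.
- apply/setP => x; rewrite !inE; case: (boolP (x \in S1)) => //= x1.
  by rewrite (subsetP sS).
Qed.

Lemma valid_indep_pair S E r : r \in S -> tree_on S E ->
  valid_pair (indep_pair S E r).
Proof.
elim/ltn_ind: {S}#|S| {-2}S (leqnn #|S|) E r => N IH S leN E r rS t.
have [eS|[m mS mr]] := set_case rS.
  move: t; rewrite eS tree_on1 => /eqP->; rewrite indep_pair1 /valid_pair /=.
  by rewrite lead_coef1 lead_coefX size_poly1 size_polyX.
have [S1 [c [E1 [E2 [m1 sub c1 t1 [t2 ->]]]]]] := tree_split t rS mS mr.
have [lt1 lt2 r2 dis eS] := split_facts rS m1 sub.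
rewrite -{1}eS indep_pair_glue //; apply: valid_join.
  exact: (IH _ (leq_trans lt1 leN) _ (leqnn _)).
exact: (IH _ (leq_trans lt2 leN) _ (leqnn _)).
Qed.

(** The total depends on neither the root nor the labels. This independence drives the induction,
    since the root [c] of the branch ranges over all of [S1] and contributes the factor [#|S1|]. *)
Lemma sum_trees_weight (g : nat -> cls -> rat) S r s :
    (forall s, g 1%N s = leaf rat s) ->
    (forall n s, g n.+2 s = \sum_(k < n.+1)
      'C(n, k)%:R * k.+1%:R * join (g k.+1) (g (n - k).+1) s) ->
    r \in S ->
  \sum_(E | tree_on S E) weight (indep_pair S E r) s = g #|S| s.
Proof.
move=> g1 gS; elim/ltn_ind: {S}#|S| {-2}S (erefl #|S|) r s => N IH S eN r s rS.
have [eS|[m mS mr]] := set_case rS.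
  rewrite eS cards1 g1 (big_pred1 set0) => [|E]; last by rewrite tree_on1.
  rewrite indep_pair1 /weight /= lead_coef1 lead_coefX size_poly1 size_polyX.
  by case: s.
rewrite (sum_trees _ rS mS mr) eN.
transitivity (\sum_(S1 : {set 'I_n} | (m \in S1) && (S1 \subset S :\ r))
    #|S1|%:R * join (g #|S1|) (g (N - #|S1|)%N) s).
  apply: eq_bigr => S1 /andP[m1 sub].
  have [lt1 lt2 r2 dis eS] := split_facts rS m1 sub.
  rewrite mulr_natl -sumr_const; apply: eq_bigr => c c1.
  transitivity (join
     (fun s => \sum_(E1 | tree_on S1 E1) weight (indep_pair S1 E1 c) s)
     (fun s => \sum_(E2 | tree_on (S :\: S1) E2) weight (indep_pair (S :\: S1) E2 r) s) s).
    rewrite /join; under [RHS]eq_bigr do rewrite big_distrlr /=.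
    rewrite [RHS]exchange_big /=; apply: eq_bigr => E1 t1.
    rewrite [RHS]exchange_big /=; apply: eq_bigr => E2 t2.
    rewrite -{1}eS indep_pair_glue // weight_join //; exact: valid_indep_pair.
  have e2 : #|S :\: S1| = (N - #|S1|)%N.
    by rewrite -eN -[in RHS]eS cardsU (disjoint_setI0 dis) cards0 subn0 addKn.
  rewrite /join; apply: eq_bigr => pq _; congr (_ * _).
    by apply: (IH _ _ _ erefl) c1; rewrite -eN.
  by rewrite -e2; apply: (IH _ _ _ erefl) r2; rewrite -eN.
(* [S1] consists of [m] and [k] further vertices chosen among those other than [r] and [m], which
   gives the binomial coefficient and [#|S1| = k.+1]. *)
rewrite (@sum_subsets_mem _ _ m (S :\ r)
  (fun k => k%:R * join (g k) (g (N - k)%N) s)); last by rewrite !inE mr.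
rewrite (@sum_subsets_card _ _ _ (fun k => k.+1%:R * join (g k.+1) (g (N - k.+1)%N) s)).
have eN2 : N = #|S :\ r :\ m|.+2.
  by rewrite -eN (cardsD1 r) rS (cardsD1 m (S :\ r)) !inE mr mS.
rewrite {2}eN2 gS; apply: eq_bigr => k _; rewrite mulrA {1}eN2 subSS subSn //.
by rewrite -ltnS.
Qed.

End Independent.

Lemma N_vcE (g : nat -> cls -> rat) n :
    (forall s, g 1%N s = leaf rat s) ->
    (forall n s, g n.+2 s = \sum_(k < n.+1)
      'C(n, k)%:R * k.+1%:R * join (g k.+1) (g (n - k).+1) s) ->
  (N_vc n.+1)%:R = min_total (g n.+1).
Proof.
move=> g1 gS; pose r : 'I_n.+1 := ord0.
have rT : r \in [set: 'I_n.+1] by rewrite inE.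
have -> : N_vc n.+1 = (\sum_(E : {set {set 'I_n.+1}} | tree_on setT E)
                        #|[set C | min_vertex_cover E C]|)%N.
  rewrite /N_vc -sum1_card.
  under [RHS]eq_bigr do rewrite -sum1_card.
  rewrite pair_big_dep /=; apply: eq_bigl => -[E C]; rewrite !inE /=.
  congr (_ && _); by apply/asboolP/idP => /is_treeE.
rewrite natr_sum /min_total.
rewrite -[in RHS](card_ord n.+1) -cardsT -!(sum_trees_weight _ g1 gS rT).
rewrite -!big_split /=; apply: eq_bigr => E t.
rewrite (card_min_vertex_cover r); last first.
  by apply/negP => e0; have [/(_ _ e0)[]] := tree_onP _ _ t; rewrite cards0.
by rewrite -min_total_weight //; apply: valid_indep_pair.
Qed.

(** * The first values *)

(* Entry [j] is the vector of class counts for trees with [j.+1] vertices. *)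
Fixpoint rooted_table (n : nat) : seq (cls -> rat) :=
  if n is n'.+1 then
    let t := rooted_table n' in
    let w j := nth (fun=> 0) t j in
    rcons t (if n' is n''.+1 then fun s =>
        \sum_(k < n''.+1) 'C(n'', k)%:R * k.+1%:R * join (w k) (w (n'' - k)%N) s
      else leaf rat)
  else [::].

(** Each value needs all earlier ones; the list makes this strong recursion structural. *)
Definition rooted_count (n : nat) : cls -> rat :=
  nth (fun=> 0) (rooted_table n) n.-1.

Lemma size_rooted_table n : size (rooted_table n) = n.
Proof. by elim: n => //= n IH; rewrite size_rcons IH. Qed.

Lemma nth_rooted_table n j : (j < n)%N ->
  nth (fun=> 0) (rooted_table n) j = rooted_count j.+1.
Proof.
elim: n => // n IH; rewrite ltnS leq_eqVlt => /orP[/eqP-> //|lt].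
by rewrite -IH //= nth_rcons size_rooted_table lt.
Qed.

Lemma rooted_count1 s : rooted_count 1 s = leaf rat s.
Proof. by []. Qed.

Lemma rooted_countS n s : rooted_count n.+2 s = \sum_(k < n.+1)
  'C(n, k)%:R * k.+1%:R * join (rooted_count k.+1) (rooted_count (n - k).+1) s.
Proof.
rewrite /rooted_count [rooted_table n.+2]/= -/(rooted_table n.+1) [n.+2.-1]/=.
rewrite nth_rcons size_rooted_table ltnn eqxx; apply: eq_bigr => k _.
by rewrite !nth_rooted_table // ltnS leq_subr.
Qed.

(* Binary integers, because the values are too large for unary [nat]. *)
Definition bin_count (n : nat) (s : cls) : N :=
  let vec a a' b b' c := match s with
    | AOut => a | AIn => a' | BIn => b | BOut => b' | CIn => c end%num in
  match n with
  | 1%N => vec 1 1 0 0 0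
  | 2%N => vec 0 0 1 1 0
  | 3%N => vec 2 4 0 0 1
  | 4%N => vec 3 3 18 18 1
  | 5%N => vec 88 196 24 24 49
  | 6%N => vec 425 605 1660 1660 191
  | 7%N => vec 13596 30996 7260 7260 7801
  | 8%N => vec 129997 217567 391524 391524 65115
  | 9%N => vec 4609088 10527056 3507952 3507952 2676521
  | 10%N => vec 70709193 129504825 177975648 177975648 37444951
  | _ => 0
  end%num.

Definition bin_join (w1 w2 : cls -> N) (s : cls) : N :=
  foldr (fun pq acc => w1 pq.1 * w2 pq.2 + acc)%num 0%num (join_rule s).

Definition bin_step (n : nat) (s : cls) : N :=
  foldr (fun k acc => N.of_nat ('C(n, k) * k.+1)%N *
      bin_join (bin_count k.+1) (bin_count (n - k).+1) s + acc)%num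
    0%num (iota 0 n.+1).

Definition ratN (x : N) : rat := (N.to_nat x)%:R.

Lemma ratN_join w1 w2 s :
  ratN (bin_join w1 w2 s) = join (ratN \o w1) (ratN \o w2) s.
Proof.
rewrite /join /bin_join; elim: (join_rule s) => [|pq l IH]; first by rewrite big_nil.
by rewrite big_cons -IH /ratN /= N2Nat.inj_add N2Nat.inj_mul natrD natrM.
Qed.

Lemma ratN_step n s : ratN (bin_step n s) = \sum_(k < n.+1)
  'C(n, k)%:R * k.+1%:R * join (ratN \o bin_count k.+1) (ratN \o bin_count (n - k).+1) s.
Proof.
rewrite -(big_mkord xpredT (fun k => 'C(n, k)%:R * k.+1%:R *
  join (ratN \o bin_count k.+1) (ratN \o bin_count (n - k).+1) s)).
rewrite /bin_step /index_iota subn0.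
elim: (iota 0 n.+1) => [|k l IH]; first by rewrite big_nil.
rewrite big_cons -IH -ratN_join /ratN [foldr _ _ _]/= N2Nat.inj_add N2Nat.inj_mul.
by rewrite Nat2N.id natrD !natrM.
Qed.

(** The literal table is a certificate: every row is recomputed from the preceding ones. *)
Lemma bin_count_step n s : (n < 9)%N -> bin_count n.+2 s = bin_step n s.
Proof. by do 9 (case: n => [_|n]; first by case: s; vm_compute). Qed.

Lemma rooted_countE n s : (0 < n <= 10)%N -> rooted_count n s = ratN (bin_count n s).
Proof.
elim/ltn_ind: n s => -[|[|n]] IH s; [by []|by case: s|].
move=> /andP[_ le]; rewrite rooted_countS bin_count_step ?ratN_step //.
apply: eq_bigr => k _; congr (_ * _); rewrite /join; apply: eq_bigr => pq _.
have lek := ltn_ord k.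
by rewrite /= !IH //; lia.
Qed.

Definition bin_total (n : nat) : N :=
  (bin_count n AOut + bin_count n BIn + bin_count n BOut + bin_count n CIn)%num.

Lemma N_vc_small n : (0 < n <= 10)%N -> N_vc n = N.to_nat (bin_total n).
Proof.
case: n => // n len; apply/eqP; rewrite -(eqr_nat rat).
rewrite (N_vcE _ rooted_count1 rooted_countS) /min_total !rooted_countE //.
by rewrite /bin_total !N2Nat.inj_add !natrD.
Qed.

(* Large [nat] literals stand for [Nat.of_num_uint] of a digit sequence, which
   must not be evaluated in unary. *)
Lemma N_vc_literal n d : (0 < n <= 10)%N -> bin_total n = N.of_num_uint d ->
  N_vc n = Nat.of_num_uint d.
Proof.
move=> len e; rewrite N_vc_small // e.
exact: (common.large_nat_N_nat (common.large_nat_uint d)).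
Qed.

Theorem theorem3 :
  (exists U : fps, U 0%N = 0%R /\ U_equation U) /\
  (forall U : fps, U 0%N = 0%R -> U_equation U -> Fvc = Fvc_formula U) /\
  [seq N_vc k | k <- iota 1 10] =
    [:: 1; 2; 3; 40; 185; 3936; 35917; 978160; 14301513; 464105440]%N.
Proof.
have [U [U0 eqU FU]] := series_solution rooted_count1 rooted_countS.
split; [by exists U | split].
  (* Any solution is the one built from the counts, for which the formula is known. *)
  move=> U' U'0 eqU'; rewrite -(U_equation_unique U0 U'0 eqU eqU').
  apply/funext => -[|k]; rewrite FU //.
  by rewrite -(N_vcE _ rooted_count1 rooted_countS).
have small n m : (0 < n <= 10)%N -> N.to_nat (bin_total n) = m -> N_vc n = m.
  by move=> /N_vc_small ->.
have e1 : N_vc 1 = 1%N by apply: small.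
have e2 : N_vc 2 = 2%N by apply: small.
have e3 : N_vc 3 = 3%N by apply: small.
have e4 : N_vc 4 = 40%N by apply: small.
have e5 : N_vc 5 = 185%N by apply: small.
have e6 : N_vc 6 = 3936%N by apply: small.
have e7 : N_vc 7 = 35917%N by apply: N_vc_literal.
have e8 : N_vc 8 = 978160%N by apply: N_vc_literal.
have e9 : N_vc 9 = 14301513%N by apply: N_vc_literal.
have e10 : N_vc 10 = 464105440%N by apply: N_vc_literal.
rewrite [iota 1 10]/= /map e1 e2 e3 e4 e5 e6 e7 e8 e9 e10.
reflexivity.
Qed.
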